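(* For any Rademacher sum $X=\sum_{i=1}^na_i\varepsilon_i\in\mathcal{X}$, we have $\mathbb{P}(|X|\geq 1/\sqrt{3})\geq 3/8$.
   Context: $\mathcal{X}$ denotes the set of Rademacher sums $X=\sum_{i=1}^na_i\varepsilon_i$ where $a_1\geq a_2\geq\dots\geq a_n>0$ are real constants with $a_1^2+\dots+a_n^2=1$ (i.e. $\mathrm{Var}(X)=1$), and the $\varepsilon_i$ are independent random signs uniformly distributed on $\{-1,+1\}$. *)

(* Defs.v *)
From mathcomp Require Import all_boot all_order all_algebra.
From mathcomp Require Import all_classical all_reals all_analysis.

Set Implicit Arguments.
Unset Strict Implicit.
Unset Printing Implicit Defensive.

Import Order.TTheory GRing.Theory Num.Theory.
Import numFieldNormedType.Exports.

Local Open Scope classical_set_scope.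
Local Open Scope ring_scope.

Definition mutually_independent (R : realType) (d : measure_display)
    (T : measurableType d) (P : probability T R) (I : finType)
    (X : I -> {RV P >-> R}) : Prop :=
  forall (J : {set I}) (B : I -> set R),
    (forall i, measurable (B i)) ->
    P (\bigcap_(i in [set` J]) (X i @^-1` B i)) =
    (\prod_(i in J) P (X i @^-1` B i))%E.

(* These two point masses add up to 1, so e is almost surely a sign. *)
Definition random_sign (R : realType) (d : measure_display)
    (T : measurableType d) (P : probability T R) (e : {RV P >-> R}) : Prop :=
  P (e @^-1` [set 1]) = (2^-1)%:E /\ P (e @^-1` [set -1]) = (2^-1)%:E.

Definition rademacher_sequence (R : realType) (d : measure_display)
    (T : measurableType d) (P : probability T R) (n : nat)
    (eps : 'I_n -> {RV P >-> R}) : Prop :=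
  mutually_independent eps /\ forall i, random_sign (eps i).

(* The sum of squares is the variance of the Rademacher sum. *)
Definition unit_weights (R : realType) (n : nat) (a : 'I_n -> R) : Prop :=
  [/\ forall i j : 'I_n, (i <= j)%N -> a j <= a i,
      forall i, 0 < a i &
      \sum_(i < n) a i ^+ 2 = 1].

Definition rademacher_sum (R : realType) (d : measure_display)
    (T : measurableType d) (P : probability T R) (n : nat)
    (a : 'I_n -> R) (eps : 'I_n -> {RV P >-> R}) : T -> R :=
  fun w => \sum_(i < n) a i * eps i w.

(* Main.v *)
(* Rescale the weights to b = sqrt 3 a, so that sum b^2 = 3 and the threshold
   becomes 1. Walk through the signed weights one at a time: by Lévy's
   inequality a path that has reached |s| >= 1 ends there with probability at
   least 1/2. To bound the chance of never leaving (-1, 1), use that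
   cos (t s) prod cos (t x) over the remaining weights x is harmonic for the
   walk, nonnegative up to the overshoot 1 + max x as long as
   t (1 + max x) <= pi/2, and at most exp (- t^2 sum x^2 / 2) at the start; a
   third harmonic cos (3 t s) sharpens the bound. Throughout, 157/100 stands for
   pi/2 and t is chosen close to the largest admissible frequency. Large
   leading weights are kept back: averaging the indicator of |s| >= 1 over
   their signs gives a new terminal function, still subject to Lévy's
   inequality, to which the harmonic bound applies for the remaining weights.
   The cases are b2 <= 0.47; b1 + b2 >= 1, with b3 at most or above 1/2;
   and b1 + b2 < 1 < b2 + 0.53, where either b6 <= 0.48 or six weights have
   nearly the same size. *)
Require Import Defs.
From mathcomp Require Import all_boot all_order all_algebra.
From mathcomp Require Import all_classical all_reals all_analysis.
From mathcomp Require Import ring lra.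
Set Implicit Arguments.
Unset Strict Implicit.
Unset Printing Implicit Defensive.
Import Order.TTheory GRing.Theory Num.Theory.
Import numFieldNormedType.Exports.
Local Open Scope classical_set_scope.
Local Open Scope ring_scope.

(** * Taylor bounds for the cosine and the exponential *)

Section Taylor.
Variable R : realType.
Implicit Types t x y z : R.

(** Mean value theorem. The Taylor bounds below apply it to their error terms, whose derivative is
    the error term of the preceding bound; the chains start from [cos_le1] and [expR_ge1Dx]. *)
Lemma ge0_of_derive (f df : R -> R) :
  (forall x, is_derive x 1 f (df x)) -> f 0 = 0 ->
  (forall x, 0 <= x -> 0 <= df x) -> forall x, 0 <= x -> 0 <= f x.
Proof.
move=> fd f0 df0 x x0.
have [c cx E] : exists2 c, c \in `[0, x]%R & f x - f 0 = df c * (x - 0).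
  apply: (@MVT_segment R f df 0 x x0).
  by apply: derivable_within_continuous => y _; have [] := fd y.
rewrite f0 !subr0 in E; rewrite E mulr_ge0//; apply: df0.
by move: cx; rewrite in_itv /= => /andP[].
Qed.

Lemma sin_le_id x : 0 <= x -> sin x <= x.
Proof.
move=> x0; rewrite -subr_ge0; move: x x0.
apply: (@ge0_of_derive (fun x => x - sin x) (fun x => 1 - cos x)).
- by rewrite sin0 subrr.
- by move=> y _; rewrite subr_ge0 cos_le1.
Qed.

Lemma cos_ge_taylor2 x : 0 <= x -> 1 - x^+2/2 <= cos x.
Proof.
move=> x0; rewrite -subr_ge0; move: x x0.
apply: (@ge0_of_derive (fun x => cos x - (1 - x^+2/2)) (fun x => x - sin x)).
- move=> y; apply: is_derive_eq; rewrite /GRing.scale /=; by field.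
- by rewrite cos0; field.
- by move=> y y0; rewrite subr_ge0 sin_le_id.
Qed.

Lemma sin_ge_taylor3 x : 0 <= x -> x - x^+3/6 <= sin x.
Proof.
move=> x0; rewrite -subr_ge0; move: x x0.
apply: (@ge0_of_derive (fun x => sin x - (x - x^+3/6)) (fun x => cos x - (1 - x^+2/2))).
- move=> y; apply: is_derive_eq; rewrite /GRing.scale /=; by field.
- by rewrite sin0; field.
- by move=> y y0; rewrite subr_ge0 cos_ge_taylor2.
Qed.

Lemma cos_le_taylor4 x : 0 <= x -> cos x <= 1 - x^+2/2 + x^+4/24.
Proof.
move=> x0; rewrite -subr_ge0; move: x x0.
apply: (@ge0_of_derive (fun x => 1 - x^+2/2 + x^+4/24 - cos x)
  (fun x => sin x - (x - x^+3/6))).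
- move=> y; apply: is_derive_eq; rewrite /GRing.scale /=; by field.
- by rewrite cos0; field.
- by move=> y y0; rewrite subr_ge0 sin_ge_taylor3.
Qed.

Lemma sin_le_taylor5 x : 0 <= x -> sin x <= x - x^+3/6 + x^+5/120.
Proof.
move=> x0; rewrite -subr_ge0; move: x x0.
apply: (@ge0_of_derive (fun x => x - x^+3/6 + x^+5/120 - sin x)
  (fun x => 1 - x^+2/2 + x^+4/24 - cos x)).
- move=> y; apply: is_derive_eq; rewrite /GRing.scale /=; by field.
- by rewrite sin0; field.
- by move=> y y0; rewrite subr_ge0 cos_le_taylor4.
Qed.

Lemma cos_ge_taylor6 x : 0 <= x -> 1 - x^+2/2 + x^+4/24 - x^+6/720 <= cos x.
Proof.
have -> : 720 = 24 * 30 :> R by ring.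
move=> x0; rewrite -subr_ge0; move: x x0.
apply: (@ge0_of_derive (fun x => cos x - (1 - x^+2/2 + x^+4/24 - x^+6/(24*30)))
  (fun x => x - x^+3/6 + x^+5/120 - sin x)).
- move=> y; apply: is_derive_eq; rewrite /GRing.scale /=; by field.
- by rewrite cos0; field.
- by move=> y y0; rewrite subr_ge0 sin_le_taylor5.
Qed.

Lemma cos_norm t x : cos (t * `|x|) = cos (t * x).
Proof. by have [_|_] := ler0P x => //; rewrite mulrN cosN. Qed.

(** As a cubic in the square of [x], the Taylor polynomial is decreasing on the whole line: after
    factoring out [z - w], the cofactor is 60 plus squares. Hence an upper bound on the square
    suffices. *)
Lemma cos_ge_of_sqr x z : x ^+ 2 <= z -> 1 - z/2 + z^+2/24 - z^+3/720 <= cos x.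
Proof.
move=> xz; rewrite -(mul1r x) -cos_norm mul1r.
apply: le_trans (cos_ge_taylor6 (normr_ge0 x)).
have -> : `|x| ^+ 4 = (x^+2)^+2 by rewrite -(real_normK (num_real x)); ring.
have -> : `|x| ^+ 6 = (x^+2)^+3 by rewrite -(real_normK (num_real x)); ring.
rewrite real_normK ?num_real//.
move: (x^+2) xz => w wz; clear -wz; rewrite -subr_ge0.
have -> : 1 - w / 2 + w ^+ 2 / 24 - w ^+ 3 / 720 -
    (1 - z / 2 + z ^+ 2 / 24 - z ^+ 3 / 720) =
  (z - w) * (60 + 3 / 4 * (z + w - 20) ^+ 2 + (z - w) ^+ 2 / 4) / (24 * 30).
  have -> : 720 = 24 * 30 :> R by ring.
  by field.
apply: divr_ge0; last by lra.
apply: mulr_ge0; first by rewrite subr_ge0.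
by have := sqr_ge0 (z + w - 20); have := sqr_ge0 (z - w); lra.
Qed.

Lemma expRN_ge_taylor1 x : 0 <= x -> 1 - x <= expR (- x).
Proof. by move=> _; have := expR_ge1Dx (- x). Qed.

Lemma is_derive_expRN x : is_derive x 1 (fun x => expR (- x)) (- expR (- x)).
Proof.
have -> : - expR (- x) = expR (- x) * (- 1 : R) by rewrite mulrN1.
exact: (@is_derive1_comp R expR (fun x => - x) x).
Qed.

Lemma expRN_le_taylor2 x : 0 <= x -> expR (- x) <= 1 - x + x^+2/2.
Proof.
move=> x0; rewrite -subr_ge0; move: x x0.
apply: (@ge0_of_derive (fun x => 1 - x + x^+2/2 - expR (- x))
  (fun x => expR (- x) - (1 - x))).
- move=> y; have ? := is_derive_expRN y.
  by apply: is_derive_eq; rewrite /GRing.scale /=; by field.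
- by rewrite oppr0 expR0; field.
- by move=> y y0; rewrite subr_ge0 expRN_ge_taylor1.
Qed.

Lemma expRN_ge_taylor3 x : 0 <= x -> 1 - x + x^+2/2 - x^+3/6 <= expR (- x).
Proof.
move=> x0; rewrite -subr_ge0; move: x x0.
apply: (@ge0_of_derive (fun x => expR (- x) - (1 - x + x^+2/2 - x^+3/6))
  (fun x => 1 - x + x^+2/2 - expR (- x))).
- move=> y; have ? := is_derive_expRN y.
  by apply: is_derive_eq; rewrite /GRing.scale /=; by field.
- by rewrite oppr0 expR0; field.
- by move=> y y0; rewrite subr_ge0 expRN_le_taylor2.
Qed.

Lemma expRN_le_taylor4 x : 0 <= x -> expR (- x) <= 1 - x + x^+2/2 - x^+3/6 + x^+4/24.
Proof.
move=> x0; rewrite -subr_ge0; move: x x0.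
apply: (@ge0_of_derive (fun x => 1 - x + x^+2/2 - x^+3/6 + x^+4/24 - expR (- x))
  (fun x => expR (- x) - (1 - x + x^+2/2 - x^+3/6))).
- move=> y; have ? := is_derive_expRN y.
  by apply: is_derive_eq; rewrite /GRing.scale /=; by field.
- by rewrite oppr0 expR0; field.
- by move=> y y0; rewrite subr_ge0 expRN_ge_taylor3.
Qed.

(** Half-angle formula: 7072/10000 exceeds the square root of 1/2, so [2 * cos (x/2) ^+2 - 1] is
    nonnegative. No numerical bound on pi is involved. *)
Lemma cos_ge0_157 x : 0 <= x -> x <= 157/100 -> 0 <= cos x.
Proof.
move=> x0 x1.
have sq : (x/2) ^+ 2 <= 6163/10000 by clear -x0 x1; nra.
have h : 7072/10000 <= cos (x/2).
  by apply: le_trans (cos_ge_of_sqr sq); clear; lra.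
have -> : cos x = 2 * cos (x/2) ^+2 - 1.
  have -> : x = x/2 + x/2 by field.
  rewrite cosD -!expr2; have := cos2Dsin2 (x/2).
  have -> : (x/2 + x/2)/2 = x/2 by field.
  by move: (cos _) (sin _) => c s; clear; lra.
by move: (cos (x/2)) h => c h; clear -h; nra.
Qed.

(** With z the square of [x], the Taylor bounds differ by z^2 (4 - z) / 48, which is where [x <= 2]
    comes from. *)
Lemma cos_le_expR x : 0 <= x -> x <= 2 -> cos x <= expR (- (x^+2/2)).
Proof.
move=> x0 x2.
apply: le_trans (cos_le_taylor4 x0) _.
have h0 : 0 <= x^+2/2 by rewrite divr_ge0 ?sqr_ge0.
apply: le_trans (expRN_ge_taylor3 h0).
have -> : x^+4 = (x^+2)^+2 by ring.
have z1 : x^+2 <= 4 by nra.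
have z0 : 0 <= x^+2 by exact: sqr_ge0.
move: (x^+2) z0 z1 => z z0 z1; clear -z0 z1.
rewrite -subr_ge0.
have -> : 1 - z / 2 + (z / 2) ^+ 2 / 2 - (z / 2) ^+ 3 / 6 - (1 - z / 2 + z ^+ 2 / 24)
  = z^+2 * (4 - z)/48 by field.
by rewrite divr_ge0// mulr_ge0 ?sqr_ge0// subr_ge0.
Qed.

End Taylor.

(** * Averages over signs and harmonic bounds *)

Section Walk.
Variable R : realType.
Implicit Types (s t x p M : R) (l : seq R) (f g : R -> R).

Definition hold x f s : R := (f (s + x) + f (s - x)) / 2.

Definition savg l f : R -> R := foldr hold f l.

Lemma savg_cons x l f s :
  savg (x :: l) f s = (savg l f (s + x) + savg l f (s - x)) / 2.
Proof. by []. Qed.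

Lemma holdC x y f : hold x (hold y f) =1 hold y (hold x f).
Proof.
move=> s; rewrite /hold.
by rewrite (addrAC s x y) (addrAC s x (-y)) (addrAC s (-x) y) (addrAC s (-x) (-y)); ring.
Qed.

Lemma eq_savg l f g : f =1 g -> savg l f =1 savg l g.
Proof. by move=> fg; elim: l => //= x l IH s; rewrite /hold !IH. Qed.

(** This is what allows a weight to be kept back: its sign may be averaged in the terminal function
    instead of along the walk. *)
Lemma savg_hold x l f : savg l (hold x f) =1 savg (x :: l) f.
Proof.
elim: l => // y l IH s; rewrite /= holdC.
by rewrite -[LHS]/(hold y (savg l (hold x f)) s) /hold !IH.
Qed.

Lemma savg_swap x y l f : savg (x :: y :: l) f =1 savg (y :: x :: l) f.
Proof. by move=> s; rewrite /= holdC. Qed.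

Lemma savg_nseq0 l f k : savg (l ++ nseq k 0) f =1 savg l f.
Proof.
move=> s; rewrite /savg foldr_cat; apply: eq_savg => {}s.
by elim: k s => //= k IH s; rewrite /hold addr0 subr0 !IH; field.
Qed.

Lemma le_savg l f g : (forall s, f s <= g s) -> forall s, savg l f s <= savg l g s.
Proof.
move=> fg; elim: l => //= x l IH s; rewrite /hold ler_pM2r//.
exact: lerD.
Qed.

Lemma savg_lin (a b : R) l f s : savg l (fun s => a + b * f s) s = a + b * savg l f s.
Proof. by elim: l s => //= x l IH s; rewrite /hold !IH; field. Qed.

Lemma savg_add l f g s : savg l (fun s => f s + g s) s = savg l f s + savg l g s.
Proof. by elim: l s => //= x l IH s; rewrite /hold !IH; field. Qed.

Lemma savg_cst (c : R) l s : savg l (fun=> c) s = c.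
Proof. by elim: l s => //= x l IH s; rewrite /hold !IH; field. Qed.

Lemma savg_reflect p l f s : savg l (fun u => f (p - u)) s = savg l f (p - s).
Proof.
elim: l s => //= x l IH s; rewrite /hold !IH addrC.
by congr ((savg l f _ + savg l f _) / 2); ring.
Qed.

(** The signed sum is symmetric, so [f] and its reflection about [s] have the same average, and the
    two averages add up to at least 1. *)
Lemma savg_half_of_reflect l f s :
  (forall u, 1 <= f (s + u) + f (s - u)) -> 2^-1 <= savg l f s.
Proof.
move=> h.
have e : savg l (fun u => f ((s + s) - u)) s = savg l f s.
  by rewrite savg_reflect addrK.
have : savg l (fun=> 1) s <= savg l (fun u => f u + f ((s + s) - u)) s.
  apply: le_savg => u; apply: le_trans (h (u - s)) _.
  have -> : s + (u - s) = u by ring.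
  by have -> : s - (u - s) = s + s - u by ring.
rewrite savg_add e.
rewrite savg_cst; lra.
Qed.

Definition outside p s : R := (p <= `|s|)%R%:R.

Lemma outside_ge0 p s : 0 <= outside p s. Proof. exact: ler0n. Qed.

Lemma outside_in p s : p <= `|s| -> outside p s = 1.
Proof. by rewrite /outside => ->. Qed.

Lemma outside_pos p s : p <= s -> outside p s = 1.
Proof. by move=> h; rewrite outside_in// (le_trans h)// ler_norm. Qed.

Lemma outside_neg p s : s <= - p -> outside p s = 1.
Proof. by move=> h; rewrite outside_in// -normrN (le_trans _ (ler_norm _))// lerNr. Qed.

Lemma outsideN p s : outside p (- s) = outside p s.
Proof. by rewrite /outside normrN. Qed.

Lemma savg_even l f s : (forall s, f (- s) = f s) -> savg l f (- s) = savg l f s.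
Proof.
move=> fe; have := savg_reflect 0 l f s; rewrite sub0r => <-.
by apply: eq_savg => u; rewrite sub0r fe.
Qed.

(* Lévy's inequality: reflecting the walk at [s] keeps one of each pair of
   paths on the far side of [s]. *)
Lemma savg_outside p l s : p <= `|s| -> 2^-1 <= savg l (outside p) s.
Proof.
wlog s0 : s / 0 <= s.
  move=> W ps; have [|/ltW s0] := leP 0 s; first by move=> /W; exact.
  rewrite -savg_even; last exact: outsideN.
  by apply: W; rewrite ?oppr_ge0 ?normrN.
rewrite ger0_norm// => ps; apply: savg_half_of_reflect => u.
have [u0|/ltW u0] := leP 0 u.
  rewrite outside_pos; last by lra.
  by rewrite lerDl outside_ge0.
rewrite (@outside_pos _ (s - u)); last by lra.
by rewrite lerDr outside_ge0.
Qed.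

Lemma savg_ge0 l f s : (forall s, 0 <= f s) -> 0 <= savg l f s.
Proof.
by move=> f0; elim: l s => //= x l IH s; rewrite /hold divr_ge0// addr_ge0.
Qed.

Definition cosprod t l : R := \prod_(x <- l) cos (t * x).

Lemma cosprod_cons t x l : cosprod t (x :: l) = cos (t * x) * cosprod t l.
Proof. by rewrite /cosprod big_cons. Qed.

Definition cosavg t l s : R := cos (t * s) * cosprod t l.

Lemma cosavg_cons t x l s :
  cosavg t (x :: l) s = (cosavg t l (s + x) + cosavg t l (s - x)) / 2.
Proof.
rewrite /cosavg cosprod_cons mulrDr mulrBr cosB cosD; by field.
Qed.

Lemma savg_cos t l s : savg l (fun s => cos (t * s)) s = cosavg t l s.
Proof.
elim: l s => [|x l IH] s; first by rewrite /cosavg /cosprod big_nil mulr1.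
by rewrite cosavg_cons /= /hold !IH.
Qed.

Lemma cosavg0 t l : cosavg t l 0 = cosprod t l.
Proof. by rewrite /cosavg mulr0 cos0 mul1r. Qed.

Definition sumsq l : R := \sum_(x <- l) x ^+ 2.

Lemma sumsq_cons x l : sumsq (x :: l) = x ^+ 2 + sumsq l.
Proof. by rewrite /sumsq big_cons. Qed.

Lemma sumsq_nil : sumsq [::] = 0.
Proof. by rewrite /sumsq big_nil. Qed.

Lemma cosprod_ge0 t l : 0 <= t ->
  {in l, forall x, 0 <= x /\ t * x <= 157/100} -> 0 <= cosprod t l.
Proof.
move=> t0 h; rewrite /cosprod big_seq prodr_ge0// => x /h[x0 x1].
by apply: cos_ge0_157; rewrite ?mulr_ge0.
Qed.

Lemma cosprod_le t l : 0 <= t ->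
  {in l, forall x, 0 <= x /\ t * x <= 157/100} ->
  cosprod t l <= expR (- (t ^+ 2 / 2 * sumsq l)).
Proof.
move=> t0; elim: l => [_|x l IH h].
  by rewrite sumsq_nil mulr0 oppr0 expR0 /cosprod big_nil.
rewrite cosprod_cons sumsq_cons mulrDr opprD expRD.
have [x0 x1] := h x (mem_head _ _).
have hl : {in l, forall x, 0 <= x /\ t * x <= 157/100}.
  by move=> y yl; apply: h; rewrite inE yl orbT.
apply: ler_pM; last exact: IH.
- by apply: cos_ge0_157 => //; exact: mulr_ge0.
- exact: cosprod_ge0.
have -> : t ^+ 2 / 2 * x ^+ 2 = (t * x) ^+ 2 / 2 by field.
by apply: cos_le_expR; [exact: mulr_ge0 | lra].
Qed.

(* Optional-stopping comparison: [U] is harmonic for the walk, bounds the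
   deficit of [f] inside the unit interval and is nonnegative on the overshoot
   region, where Lévy's inequality takes over. *)
Lemma savg_ge_harmonic M f (U : seq R -> R -> R) (Q : R -> Prop) :
  (forall x, Q x -> 0 <= x <= M) ->
  (forall x l s, U (x :: l) s = (U l (s + x) + U l (s - x)) / 2) ->
  (forall s, `|s| < 1 -> 2^-1 - U [::] s <= f s) ->
  (forall l s, 1 <= `|s| -> 2^-1 <= savg l f s) ->
  (forall l s, (forall x, x \in l -> Q x) -> 1 <= `|s| -> `|s| <= 1 + M -> 0 <= U l s) ->
  forall l, (forall x, x \in l -> Q x) ->
  forall s, `|s| <= 1 + M -> 2^-1 - U l s <= savg l f s.
Proof.
move=> QM Uc fU fL U0; elim=> [|x l IH] hl s sM.
  have [s1|s1] := ltP `|s| 1; first exact: fU.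
  by apply: le_trans (fL [::] s s1); rewrite gerBl U0.
have [s1|s1] := ltP `|s| 1; last first.
  by apply: le_trans (fL (x :: l) s s1); rewrite gerBl U0.
have hl' : forall y, y \in l -> Q y.
  by move=> y yl; apply: hl; rewrite inE yl orbT.
have /andP[x0 xM] := QM _ (hl _ (mem_head _ _)).
rewrite Uc /= /hold.
(* A step taken from inside the unit interval overshoots by at most [M], so the induction hypothesis
   covers both neighbours. *)
have h1 : `|s + x| <= 1 + M.
  by rewrite (le_trans (ler_normD _ _))// (ger0_norm x0) lerD// ltW.
have h2 : `|s - x| <= 1 + M.
  by rewrite (le_trans (ler_normB _ _))// (ger0_norm x0) lerD// ltW.
have := IH hl' _ h1; have := IH hl' _ h2; lra.
Qed.

End Walk.

(** * Cosine comparison functions and their numerical evaluation *)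

Section Comparison.
Variable R : realType.
Implicit Types (s t x y z q r p M C : R) (l : seq R) (f : R -> R).

(** The exponent is cut into [n] pieces of size [z], small enough for the degree-four Taylor bound
    to be accurate; [q] and [r] are rational roundings. *)
Lemma expRN_le_pow (n : nat) z q r y :
  0 <= z -> n%:R * z <= y -> 1 - z + z^+2/2 - z^+3/6 + z^+4/24 <= q ->
  q ^+ n <= r -> expR (- y) <= r.
Proof.
move=> z0 zy zq qr.
have h : expR (- z) <= q := le_trans (expRN_le_taylor4 z0) zq.
apply: le_trans qr; apply: (@le_trans _ _ (expR (- z) ^+ n)).
  by rewrite -expRM_natl mulrN ler_expR lerN2.
by rewrite lerXn2r ?nnegrE ?expR_ge0// (le_trans (expR_ge0 _) h).
Qed.

Lemma cosavgN t l s : cosavg t l (- s) = cosavg t l s.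
Proof. by rewrite /cosavg mulrN cosN. Qed.

Lemma cosavg_ge0 t M l s : 0 <= t -> t * (1 + M) <= 157/100 ->
  (forall x, x \in l -> 0 <= x <= M) -> `|s| <= 1 + M -> 0 <= cosavg t l s.
Proof.
move=> t0 tM hl sM; rewrite /cosavg mulr_ge0//.
  rewrite -cos_norm cos_ge0_157 ?mulr_ge0//.
  by rewrite (le_trans _ tM)// ler_wpM2l.
apply: cosprod_ge0 => // x /hl/andP[x0 xM]; split => //.
by rewrite (le_trans _ tM)// ler_wpM2l// (le_trans xM)// lerDr.
Qed.

Lemma cos3x x : cos (3 * x) = 4 * cos x ^+ 3 - 3 * cos x.
Proof.
have -> : 3 * x = x + x + x by ring.
rewrite (cosD (x + x)) cosD sinD.
transitivity (cos x * (cos x ^+ 2 - 3 * sin x ^+ 2)); first by ring.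
have -> : sin x ^+ 2 = 1 - cos x ^+ 2 by rewrite -(cos2Dsin2 x) addrC addKr.
by ring.
Qed.

(** Makes [4 * cos x ^+ 2 - 3] nonpositive, hence the third harmonic has the favourable sign
    throughout the overshoot region. *)
Lemma cos_sqr_le x : 104/100 <= x -> x <= 157/100 -> cos x ^+ 2 <= 3/4.
Proof.
move=> x1 x2.
have c0 : 0 <= cos x by apply: cos_ge0_157 => //; lra.
have h : cos x <= 6/10.
  apply: le_trans (cos_le_taylor4 _) _; first by lra.
  have -> : x^+4 = (x^+2)^+2 by ring.
  have z0 : 108/100 <= x^+2 by clear -x1; nra.
  have z1 : x^+2 <= 247/100 by clear -x1 x2; nra.
  by move: (x^+2) z0 z1 => z z0 z1; clear -z0 z1; nra.
by move: (cos x) c0 h => c c0 h; clear -c0 h; nra.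
Qed.

Lemma savg_ge_cos t M C f :
  0 <= t -> 0 <= C -> t * (1 + M) <= 157/100 ->
  (forall s, `|s| < 1 -> 2^-1 - C * cos (t * s) <= f s) ->
  (forall l s, 1 <= `|s| -> 2^-1 <= savg l f s) ->
  forall l, (forall x, x \in l -> 0 <= x <= M) ->
  forall s, `|s| <= 1 + M -> 2^-1 - C * cosavg t l s <= savg l f s.
Proof.
move=> t0 C0 tM fU fL l hl s sM.
apply: (@savg_ge_harmonic _ M f (fun l s => C * cosavg t l s)
  (fun x => 0 <= x <= M)) => //.
- by move=> x {}l {hl sM}s; rewrite cosavg_cons; field.
- move=> {hl sM}s s1; apply: le_trans (fU s s1).
  by rewrite /cosavg /cosprod big_nil mulr1.
- by move=> l' s' hl' s1 sM'; rewrite mulr_ge0//; apply: (@cosavg_ge0 _ M).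
Qed.

(** On the overshoot region [cos (3 * t * s)] is nonpositive, so subtracting it keeps the comparison
    function nonnegative there; [3 * t * M <= 157/100] controls the sign of the remaining
    product. *)
Lemma savg_ge_cos3 t M c1 c3 f :
  104/100 <= t -> 0 <= c1 -> 0 <= c3 -> t * (1 + M) <= 157/100 ->
  3 * t * M <= 157/100 ->
  (forall s, `|s| < 1 -> 2^-1 - (c1 * cos (t * s) - c3 * cos (3 * t * s)) <= f s) ->
  (forall l s, 1 <= `|s| -> 2^-1 <= savg l f s) ->
  forall l, (forall x, x \in l -> 0 <= x <= M) ->
  forall s, `|s| <= 1 + M ->
  2^-1 - (c1 * cosavg t l s - c3 * cosavg (3 * t) l s) <= savg l f s.
Proof.
move=> t1 c10 c30 tM t3M fU fL l hl s sM.
have t0 : 0 <= t by clear -t1; lra.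
apply: (@savg_ge_harmonic _ M f (fun l s => c1 * cosavg t l s - c3 * cosavg (3 * t) l s)
  (fun x => 0 <= x <= M)) => //.
- by move=> x {}l {hl sM}s; rewrite !cosavg_cons; field.
- move=> {hl sM}s s1; apply: le_trans (fU s s1).
  by rewrite /cosavg /cosprod !big_nil !mulr1.
move=> l' s' hl' s1 sM'; rewrite subr_ge0; apply: (@le_trans _ _ 0); last first.
  by rewrite mulr_ge0//; apply: (@cosavg_ge0 _ M).
apply: mulr_ge0_le0 => //; apply: mulr_le0_ge0; last first.
  apply: cosprod_ge0; first by rewrite mulr_ge0.
  move=> x /hl'/andP[x0 xM]; split => //.
  by rewrite (le_trans _ t3M)// ler_wpM2l// mulr_ge0.
have y1 : 104/100 <= t * `|s'| by rewrite (le_trans t1)// ler_peMr.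
have y2 : t * `|s'| <= 157/100 by rewrite (le_trans _ tM)// ler_wpM2l.
have c0 : 0 <= cos (t * `|s'|) by apply: cos_ge0_157 => //; clear -y1; lra.
rewrite -cos_norm -mulrA cos3x.
have := cos_sqr_le y1 y2.
move: (cos _) c0 => c c0 h; clear -c0 h.
have -> : 4 * c ^+ 3 - 3 * c = c * (4 * c ^+ 2 - 3) by ring.
by rewrite mulr_ge0_le0//; lra.
Qed.

(* Three moves [z], [x], [y]: only the paths that return between both first
   moves and then step back can stay inside [-1, 1]. *)
Lemma savg_three_moves x y z l :
  1 <= z + x -> 0 <= z -> z <= x -> 0 <= y -> 1 <= x + y - z ->
  3/8 <= savg [:: z, x, y & l] (outside 1) 0.
Proof.
move=> zx z0 zlex y0 xyz.
have L (a : R) : 1 <= `|a| -> 2^-1 <= savg l (outside 1) a by exact: savg_outside.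
have P a : 0 <= savg l (outside 1) a by apply: savg_ge0 => s; exact: outside_ge0.
have p (u : R) : 1 <= u -> 1 <= `|u| by move=> h; rewrite (le_trans h)// ler_norm.
have L' (u : R) : 1 <= `|u| -> 2^-1 <= savg (y :: l) (outside 1) u by exact: savg_outside.
rewrite !(savg_cons z) !(savg_cons x).
have h1 : 2^-1 <= savg (y :: l) (outside 1) (0 + z + x).
  by apply: L'; apply: p; clear -zx; lra.
have h2 : 2^-1 <= savg (y :: l) (outside 1) (0 - z - x).
  by apply: L'; rewrite -normrN; apply: p; clear -zx; lra.
rewrite !(savg_cons y) in h1 h2 *.
have h3 : 2^-1 <= savg l (outside 1) (0 - z + x + y).
  by apply: L; apply: p; clear -xyz; lra.
have h4 : 2^-1 <= savg l (outside 1) (0 + z - x - y).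
  by apply: L; rewrite -normrN; apply: p; clear -xyz; lra.
have h5 := P (0 - z + x - y); have h6 := P (0 + z - x + y).
lra.
Qed.

End Comparison.

(** * Small second weight *)

Section SmallSecond.
Variable R : realType.
Implicit Types (s t x y z : R) (l : seq R) (f : R -> R).

(** The degree-four polynomial decreases in the square of [x] only up to 6, hence the condition that
    the two squares add up to at most 12. *)
Lemma cos_le_of_sqr x z : z <= x ^+ 2 -> x ^+ 2 + z <= 12 ->
  cos x <= 1 - z/2 + z^+2/24.
Proof.
move=> xz xz2; rewrite -(mul1r x) -cos_norm mul1r.
apply: le_trans (cos_le_taylor4 (normr_ge0 x)) _.
have -> : `|x| ^+ 4 = (x^+2)^+2 by rewrite -(real_normK (num_real x)); ring.
rewrite real_normK ?num_real//.
move: (x^+2) xz xz2 => w wz wz2; clear -wz wz2; rewrite -subr_ge0.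
have -> : 1 - z / 2 + z ^+ 2 / 24 - (1 - w / 2 + w ^+ 2 / 24) =
  (w - z) * (12 - (w + z)) / 24 by field.
by rewrite divr_ge0 ?mulr_ge0 ?subr_ge0.
Qed.

Lemma sqr_mul_le1 t s : `|s| < 1 -> (t * s) ^+ 2 <= t ^+ 2.
Proof.
move=> s1; rewrite exprMn -[leRHS]mulr1 ler_wpM2l ?sqr_ge0//.
by rewrite -real_normK ?num_real// expr_le1// ltW.
Qed.

Lemma savg_small_second b l :
  0 <= b -> b < 1 -> (forall x, x \in l -> 0 <= x <= 47/100) ->
  b ^+ 2 + sumsq l = 3 -> 3/8 <= savg (b :: l) (outside 1) 0.
Proof.
move=> b0 b1 hl hs.
(* Chosen so that [t * (1 + 47/100)] is exactly 157/100. *)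
pose t : R := 157/147.
have t0 : 0 <= t by rewrite /t; clear; lra.
have t2u : t^+2 <= 11407/10000 by rewrite /t; clear; lra.
have t2l : 1140/1000 <= t^+2 by rewrite /t; clear; lra.
(* The coefficients differ by 1/2, so the bound is tight at [s = 0]. It holds as long as the cosine
   is at least 48/100. *)
have hU : forall s, `|s| < 1 ->
    2^-1 - (169/250 * cos (t * s) - 22/125 * cos (3 * t * s)) <= outside 1 s.
  move=> s s1; apply: le_trans (outside_ge0 1 s).
  rewrite -(mulrA 3) cos3x.
  have h : 48/100 <= cos (t * s).
    have := cos_ge_of_sqr (le_trans (sqr_mul_le1 t s1) t2u).
    by move: (cos _) => c; clear; lra.
  have h1 := cos_le1 (t * s); move: (cos (t * s)) h h1 => y y1 y2.
  clear -y1 y2; rewrite subr_le0 -subr_ge0.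
  have -> : 169 / 250 * y - 22 / 125 * (4 * y ^+ 3 - 3 * y) - 2^-1 =
    (1 - y) * (88 / 125 * (y * (1 + y)) - 1/2) by field.
  by rewrite mulr_ge0//; [lra|nra].
have key : forall s, `|s| <= 147/100 ->
  2^-1 - (169/250 * cosavg t l s - 22/125 * cosavg (3 * t) l s) <= savg l (outside 1) s.
  move=> s s1; apply: (@savg_ge_cos3 _ t (47/100)) => [| | | | | |l' s'||].
  - by rewrite /t; clear; lra.
  - by clear; lra.
  - by clear; lra.
  - by rewrite /t; clear; lra.
  - by rewrite /t; clear; lra.
  - exact: hU.
  - exact: savg_outside.
  - exact: hl.
  - by apply: le_trans s1 _; clear; lra.
(* The leading weight may exceed 47/100, so its step is taken by hand and the bound is used from [b]
   and from [- b]. *)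
rewrite savg_cons !add0r.
have k1 := key b; have k2 := key (- b).
rewrite ?normrN ger0_norm// in k1 k2.
have bm : b <= 147/100 by clear -b1; lra.
have {}k1 := k1 bm; have {}k2 := k2 bm.
rewrite !cosavgN in k2.
have e1 : cosavg t l b <= 183/1000.
  have -> : cosavg t l b = cosprod t (b :: l) by rewrite cosprod_cons.
  apply: le_trans (cosprod_le t0 _) _.
    move=> x; rewrite inE => /predU1P[->|/hl/andP[x0 x1]]; split => //; rewrite /t.
      by clear -b0 b1; lra.
    by clear -x0 x1; lra.
  rewrite sumsq_cons hs; apply: (@expRN_le_pow _ 4 (425/1000) (6539/10000)).
  - by clear; lra.
  - by move: (t^+2) t2l => u; clear; lra.
  - by clear; lra.
  - by clear; lra.
(* The Gaussian exponent at frequency [3 * t] is at least 10, so the crude bound -1 on the cosine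
   factor is affordable. *)
have e2 : - cosavg (3 * t) l b <= 1/1000.
  rewrite /cosavg -mulNr.
  have cp0 : 0 <= cosprod (3 * t) l.
    apply: cosprod_ge0; first by rewrite mulr_ge0.
    by move=> x /hl/andP[x0 x1]; split => //; rewrite /t; clear -x0 x1; lra.
  apply: (@le_trans _ _ (1 * cosprod (3 * t) l)).
    by rewrite ler_wpM2r// lerNl cos_geN1.
  rewrite mul1r; apply: le_trans (cosprod_le _ _) _.
  - by rewrite mulr_ge0.
  - by move=> x /hl/andP[x0 x1]; split => //; rewrite /t; clear -x0 x1; lra.
  apply: (@expRN_le_pow _ 10 1 (375/1000)).
  - by clear; lra.
  - have sl : 2 <= sumsq l by clear -hs b0 b1; nra.
    by rewrite exprMn; move: (t^+2) (sumsq l) t2l sl => u v; clear; nra.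
  - by clear; lra.
  - by clear; lra.
by clear -k1 k2 e1 e2; lra.
Qed.

End SmallSecond.

(** * Two leading weights of sum at least one *)

Section PairHeld.
Variable R : realType.
Implicit Types (s t x y z : R) (l : seq R) (f : R -> R).

Lemma savg_hold2 x y l f : savg l (hold x (hold y f)) =1 savg [:: x, y & l] f.
Proof. by move=> s; rewrite savg_hold !savg_cons !savg_hold. Qed.

Lemma savg_rot3 x y z l f : savg [:: x, y, z & l] f =1 savg [:: z, x, y & l] f.
Proof. by move=> s; rewrite [RHS]savg_swap !(savg_cons x) !(savg_swap z y). Qed.

Lemma holdN x f : (forall s, f (- s) = f s) -> forall s, hold x f (- s) = hold x f s.
Proof.
move=> fe s; rewrite /hold -(fe (- s + x)) -(fe (- s - x)).
by rewrite !opprD !opprK addrC.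
Qed.

Definition pairheld x y : R -> R := hold x (hold y (outside 1)).

Lemma pairheldE x y s : pairheld x y s =
  (outside 1 (s + x + y) + outside 1 (s + x - y) +
   (outside 1 (s - x + y) + outside 1 (s - x - y))) / 4.
Proof. by rewrite /pairheld /hold; field. Qed.

Lemma pairheldN x y s : pairheld x y (- s) = pairheld x y s.
Proof. by apply: holdN; apply: holdN => u; exact: outsideN. Qed.

Lemma pairheld_norm x y s : pairheld x y `|s| = pairheld x y s.
Proof. by have [_|_] := ler0P s => //; rewrite pairheldN. Qed.

Lemma savg_pairheld_ge x y l s : 1 <= `|s| -> 2^-1 <= savg l (pairheld x y) s.
Proof. by move=> s1; rewrite savg_hold2; exact: savg_outside. Qed.

(** One of the four sign patterns always leads outside: both weights in the direction of [s]. The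
    two lemmas that follow exhibit a second pattern, for [s] near 0 and for [s] far from 0. *)
Lemma pairheld_ge_quarter x y s : 1 <= x + y -> 4^-1 <= pairheld x y s.
Proof.
move=> xy; rewrite -pairheld_norm; have := normr_ge0 s; move: `|s| => {}s s0.
rewrite pairheldE (@outside_pos _ 1 (s + x + y)); last by lra.
have := outside_ge0 1 (s + x - y); have := outside_ge0 1 (s - x + y).
by have := outside_ge0 1 (s - x - y); lra.
Qed.

Lemma pairheld_ge_half_in x y s : 1 <= x + y -> `|s| <= x + y - 1 ->
  2^-1 <= pairheld x y s.
Proof.
move=> xy; rewrite -pairheld_norm; have := normr_ge0 s; move: `|s| => {}s s0 h.
rewrite pairheldE (@outside_pos _ 1 (s + x + y)); last by lra.
rewrite (@outside_neg _ 1 (s - x - y)); last by lra.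
by have := outside_ge0 1 (s + x - y); have := outside_ge0 1 (s - x + y); lra.
Qed.

Lemma pairheld_ge_half_out x y s : 1 <= x + y -> 1 - x + y <= `|s| ->
  2^-1 <= pairheld x y s.
Proof.
move=> xy; rewrite -pairheld_norm; have := normr_ge0 s; move: `|s| => {}s s0 h.
rewrite pairheldE (@outside_pos _ 1 (s + x + y)); last by lra.
rewrite (@outside_pos _ 1 (s + x - y)); last by lra.
by have := outside_ge0 1 (s - x + y); have := outside_ge0 1 (s - x - y); lra.
Qed.

Lemma cosprod_le_pow (n : nat) t v z q r l : 0 <= t ->
  (forall x, x \in l -> 0 <= x /\ t * x <= 157/100) ->
  v <= sumsq l -> 0 <= z -> n%:R * z <= t ^+ 2 / 2 * v ->
  1 - z + z^+2/2 - z^+3/6 + z^+4/24 <= q -> q ^+ n <= r -> cosprod t l <= r.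
Proof.
move=> t0 hl vl z0 zv zq qr; apply: le_trans (cosprod_le t0 hl) _.
apply: (expRN_le_pow z0 _ zq qr); apply: le_trans zv _.
by rewrite ler_wpM2l// divr_ge0// sqr_ge0.
Qed.

(** Only the value 1/4 of the terminal function is used. The coefficients 1/3 and 1/12 differ by the
    deficit 1/4, and 157/150 is just below pi/3, so the cosine stays above 1/2. *)
Lemma savg_pair_large_rest x y l :
  1 <= x + y -> (forall u, u \in l -> 0 <= u <= 1/2) -> 9/5 <= sumsq l ->
  3/8 <= savg [:: x, y & l] (outside 1) 0.
Proof.
move=> xy hl hs.
pose t : R := 157/150.
have t0 : 0 <= t by rewrite /t; clear; lra.
have t2u : t^+2 <= 10956/10000 by rewrite /t; clear; lra.
have t2l : 10955/10000 <= t^+2 by rewrite /t; clear; lra.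
have hU : forall s, `|s| < 1 ->
    2^-1 - (1/3 * cos (t * s) - 1/12 * cos (3 * t * s)) <= pairheld x y s.
  move=> s s1; apply: le_trans (pairheld_ge_quarter s xy).
  rewrite -(mulrA 3) cos3x.
  have h : 5/10 <= cos (t * s).
    have := cos_ge_of_sqr (le_trans (sqr_mul_le1 t s1) t2u).
    by move: (cos _) => c; clear; lra.
  have h1 := cos_le1 (t * s); move: (cos (t * s)) h h1 => c y1 y2.
  clear -y1 y2; rewrite -subr_ge0.
  have -> : 4^-1 - (2^-1 - (1 / 3 * c - 1 / 12 * (4 * c ^+ 3 - 3 * c))) =
    (1 - c) * (c * (1 + c) / 3 - 1/4) by field.
  by rewrite mulr_ge0//; [lra|nra].
have h0 : `|0 : R| <= 1 + 1/2 by rewrite normr0; clear; lra.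
have key : 2^-1 - (1/3 * cosavg t l 0 - 1/12 * cosavg (3 * t) l 0)
    <= savg l (pairheld x y) 0.
  apply: (@savg_ge_cos3 _ t (1/2)) => [| | | | | |l' s'||].
  - by rewrite /t; clear; lra.
  - by clear; lra.
  - by clear; lra.
  - by rewrite /t; clear; lra.
  - by rewrite /t; clear; lra.
  - exact: hU.
  - exact: savg_pairheld_ge.
  - exact: hl.
  - exact: h0.
rewrite savg_hold2 !cosavg0 in key; apply: le_trans key.
have e1 : cosprod t l <= 3735/10000.
  apply: (@cosprod_le_pow 4 t (9/5) (2464/10000) (7817/10000)).
  - exact: t0.
  - by move=> u /hl/andP[x0 x1]; split => //; rewrite /t; clear -x0 x1; lra.
  - exact: hs.
  - by clear; lra.
  - by move: (t^+2) t2l => u; clear; lra.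
  - by clear; lra.
  - by clear; lra.
have e2 : 0 <= cosprod (3 * t) l.
  apply: cosprod_ge0; first by rewrite mulr_ge0.
  by move=> u /hl/andP[x0 x1]; split => //; rewrite /t; clear -x0 x1; lra.
by clear -e1 e2; lra.
Qed.

(** A large sum of squares with sum below 3/2 forces [x - y] to be large, so the terminal function
    is already 1/2 from 62/100 on, and a single cosine is enough. *)
Lemma savg_pair_unbalanced x y l :
  y <= x -> x < 1 -> 1 <= x + y -> x + y < 3/2 -> 6/5 < x ^+ 2 + y ^+ 2 ->
  (forall u, u \in l -> 0 <= u <= 1/2) -> x ^+ 2 + y ^+ 2 + sumsq l = 3 ->
  3/8 <= savg [:: x, y & l] (outside 1) 0.
Proof.
move=> yx x1 xy xy2 xys hl hs.
have gap : 1 - x + y <= 62/100 by clear -yx x1 xy xy2 xys; nra.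
have rest : 7/4 <= sumsq l.
  have : x ^+ 2 + y ^+ 2 <= 5/4 by clear -yx x1 xy xy2; nra.
  by clear -hs; lra.
pose t : R := 157/150.
have t0 : 0 <= t by rewrite /t; clear; lra.
have t2u : t^+2 <= 10956/10000 by rewrite /t; clear; lra.
have t2l : 10955/10000 <= t^+2 by rewrite /t; clear; lra.
have hU : forall s, `|s| < 1 -> 2^-1 - 63/200 * cos (t * s) <= pairheld x y s.
  move=> s s1.
  have [sg|sg] := leP (62/100) `|s|.
    apply: (@le_trans _ _ 2^-1); last first.
      by apply: pairheld_ge_half_out => //; exact: le_trans sg.
    have : 0 <= cos (t * s).
      rewrite -cos_norm; apply: cos_ge0_157; first by rewrite mulr_ge0.
      by rewrite /t; clear -s1; lra.
    by move: (cos _) => c; clear; lra.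
  apply: le_trans (pairheld_ge_quarter s xy).
  have h : (t * s) ^+ 2 <= 4212/10000.
    rewrite exprMn -(real_normK (num_real s)).
    have := normr_ge0 s; move: `|s| (t^+2) t2u t2l sg => u v; clear; nra.
  have := cos_ge_of_sqr h; move: (cos _) => c; clear; lra.
have h0 : `|0 : R| <= 1 + 1/2 by rewrite normr0; clear; lra.
have key : 2^-1 - 63/200 * cosavg t l 0 <= savg l (pairheld x y) 0.
  apply: (@savg_ge_cos _ t (1/2)) => [| | | |l' s'||].
  - exact: t0.
  - by clear; lra.
  - by rewrite /t; clear; lra.
  - exact: hU.
  - exact: savg_pairheld_ge.
  - exact: hl.
  - exact: h0.
rewrite savg_hold2 !cosavg0 in key; apply: le_trans key.
have e1 : cosprod t l <= 39/100.
  apply: (@cosprod_le_pow 4 t (7/4) (2396/10000) (79/100)).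
  - exact: t0.
  - by move=> u /hl/andP[u0 u1]; split => //; rewrite /t; clear -u0 u1; lra.
  - exact: rest.
  - by clear; lra.
  - by move: (t^+2) t2l => u; clear; lra.
  - by clear; lra.
  - by clear; lra.
by clear -e1; lra.
Qed.

(** Now [x + y - 1] is at least 447/1000, so there is no deficit near 0. The coefficients are
    therefore equal and the comparison function vanishes at 0; the small remaining weights admit the
    larger frequency 127/100. *)
Lemma savg_pair_small_rest x y l :
  0 <= y -> y <= x -> x < 1 -> 6/5 < x ^+ 2 + y ^+ 2 ->
  (forall u, u \in l -> 0 <= u <= 1 - x) -> x ^+ 2 + y ^+ 2 + sumsq l = 3 ->
  3/8 <= savg [:: x, y & l] (outside 1) 0.
Proof.
move=> y0 yx x1 xys hl hs.
have x2 : 7745/10000 <= x by clear -y0 yx x1 xys; nra.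
have prod : 447/1000 <= x * y.
  (* Expanding the product of [1 - x^+2] and [1 - y^+2] bounds the squared product below by the sum
     of squares minus 1. *)
  have h : 1/5 <= (x * y) ^+ 2.
    rewrite exprMn; have : 0 <= (1 - x^+2) * (1 - y^+2).
      by rewrite mulr_ge0//; clear -y0 yx x1; nra.
    by move: (x^+2) (y^+2) xys => u v; clear; lra.
  have : 0 <= x * y by rewrite mulr_ge0// (le_trans y0).
  by move: (x * y) h => u; clear; nra.
have xy : 1447/1000 <= x + y by clear -y0 yx xys prod; nra.
have xy1 : 1 <= x + y by clear -xy; lra.
have rest : 1 <= sumsq l.
  have : x ^+ 2 + y ^+ 2 <= 2 by clear -y0 yx x1; nra.
  by clear -hs; lra.
have hl' u : u \in l -> 0 <= u <= 2255/10000.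
  by move=> /hl/andP[-> /= h]; apply: le_trans h _; clear -x2; lra.
pose t : R := 127/100.
have t0 : 0 <= t by rewrite /t; clear; lra.
have t2 : t^+2 = 16129/10000 by rewrite /t; clear; lra.
have hU : forall s, `|s| < 1 ->
    2^-1 - (27/100 * cos (t * s) - 27/100 * cos (3 * t * s)) <= pairheld x y s.
  move=> s s1; rewrite -(mulrA 3) cos3x.
  have h0 := cos_ge_of_sqr (sqr_mul_le1 t s1); rewrite t2 in h0.
  have h : 29/100 <= cos (t * s) by move: (cos _) h0 => c; clear; lra.
  have [sg|sg] := leP `|s| (447/1000).
    apply: (@le_trans _ _ 2^-1); last first.
      by apply: pairheld_ge_half_in => //; apply: le_trans sg _; clear -xy; lra.
    have := cos_le1 (t * s); move: (cos _) h => c; clear => c0 c1.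
    rewrite -subr_ge0.
    have -> : 2^-1 - (2^-1 - (27 / 100 * c - 27 / 100 * (4 * c ^+ 3 - 3 * c))) =
      27/25 * c * ((1 - c) * (1 + c)) by field.
    by apply: mulr_ge0; [apply: mulr_ge0|apply: mulr_ge0]; lra.
  apply: le_trans (pairheld_ge_quarter s xy1).
  have h1 : cos (t * s) <= 844/1000.
    have hz : 322/1000 <= (t * s) ^+ 2.
      rewrite exprMn t2 -(real_normK (num_real s)).
      by move: `|s| sg => u; clear; nra.
    have hz2 := sqr_mul_le1 t s1; rewrite t2 in hz2.
    have hz3 : (t * s) ^+ 2 + 322/1000 <= 12.
      by move: (_ ^+ 2) hz2 => u; clear; lra.
    by have := cos_le_of_sqr hz hz3; move: (cos _) => c; clear; lra.
  move: (cos _) h h1 => c; clear => c0 c1.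
  (* The third root is minus the sum of the other two, so the quadratic term vanishes and the cubic
     compares directly with [c - c^3]. *)
  have : 0 <= (c - 29/100) * (844/1000 - c) * (c + 1134/1000).
    by apply: mulr_ge0; [apply: mulr_ge0|]; lra.
  lra.
have h0 : `|0 : R| <= 1 + 2255/10000 by rewrite normr0; clear; lra.
have key : 2^-1 - (27/100 * cosavg t l 0 - 27/100 * cosavg (3 * t) l 0)
    <= savg l (pairheld x y) 0.
  apply: (@savg_ge_cos3 _ t (2255/10000)) => [| | | | | |l' s'||].
  - by rewrite /t; clear; lra.
  - by clear; lra.
  - by clear; lra.
  - by rewrite /t; clear; lra.
  - by rewrite /t; clear; lra.
  - exact: hU.
  - exact: savg_pairheld_ge.
  - exact: hl'.
  - exact: h0.
rewrite savg_hold2 !cosavg0 in key; apply: le_trans key.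
have e1 : cosprod t l <= 45/100.
  apply: (@cosprod_le_pow 4 t 1 (2/10) (8188/10000)).
  - exact: t0.
  - by move=> u /hl'/andP[u0 u1]; split => //; rewrite /t; clear -u0 u1; lra.
  - exact: rest.
  - by clear; lra.
  - by rewrite t2; clear; lra.
  - by clear; lra.
  - by clear; lra.
have e2 : 0 <= cosprod (3 * t) l.
  apply: cosprod_ge0; first by rewrite mulr_ge0.
  by move=> u /hl'/andP[u0 u1]; split => //; rewrite /t; clear -u0 u1; lra.
by clear -e1 e2; lra.
Qed.

(** If the pair has small squares, much variance remains. Otherwise either [x + y - 1 < z] and the
    pair is unbalanced, or [x + z < 1] bounds the rest by [1 - x], or the three moves [z], [x], [y]
    suffice. *)
Lemma savg_pair_half x y z l :
  0 <= z -> z <= y -> y <= x -> x < 1 -> 1 <= x + y -> z <= 1/2 ->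
  (forall u, u \in l -> 0 <= u <= z) ->
  x ^+ 2 + y ^+ 2 + sumsq (z :: l) = 3 ->
  3/8 <= savg [:: x, y, z & l] (outside 1) 0.
Proof.
move=> z0 zy yx x1 xy z1 hl hs.
have hl' u : u \in z :: l -> 0 <= u <= z.
  by rewrite inE => /predU1P[->|/hl//]; rewrite z0 lexx.
have hl2 u : u \in z :: l -> 0 <= u <= 1/2.
  by move=> /hl'/andP[-> /= h]; exact: le_trans z1.
have [sq|sq] := leP (x^+2 + y^+2) (6/5).
  by apply: savg_pair_large_rest => //; clear -sq hs; lra.
have [c1|c1] := ltP (x + y - 1) z.
  by apply: savg_pair_unbalanced => //; clear -c1 z1; lra.
have [c2|c2] := ltP (x + z) 1.
  apply: savg_pair_small_rest => //; first exact: le_trans zy.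
  by move=> u /hl'/andP[-> /= h]; apply: le_trans h _; clear -c2; lra.
rewrite savg_rot3; apply: savg_three_moves => //.
- by clear -c2; lra.
- exact: le_trans yx.
- exact: le_trans zy.
- by clear -c1; lra.
Qed.

End PairHeld.

(** * Three leading weights above one half *)

Section TripleHeld.
Variable R : realType.
Implicit Types (s t x y z p q r : R) (l : seq R) (f : R -> R).

(* After the moves [x3], [x4] the walk has left or sits at [x3 - x4] up to
   sign, and from there [x1], [x2] in the same direction lead outside. *)
Lemma savg_four_large x1 x2 x3 x4 l :
  0 <= x4 -> x4 <= x3 -> x3 <= x2 -> x2 <= x1 -> 1 <= x3 + x4 ->
  3/8 <= savg [:: x1, x2, x3, x4 & l] (outside 1) 0.
Proof.
move=> p4 o3 o2 o1 h.
have L (a : R) : 1 <= a -> 2^-1 <= savg l (outside 1) a.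
  by move=> a1; apply: savg_outside; rewrite (le_trans a1)// ler_norm.
have L' k (a : R) : a <= -1 -> 2^-1 <= savg k (outside 1) a.
  by move=> a1; apply: savg_outside; rewrite -normrN (le_trans _ (ler_norm _))// lerNr.
have P (a : R) : 0 <= savg l (outside 1) a by apply: savg_ge0 => s; exact: outside_ge0.
rewrite savg_rot3 (savg_cons x3) !(savg_rot3 x1) !(savg_cons x4).
have h1 : 2^-1 <= savg [:: x1, x2 & l] (outside 1) (0 + x3 + x4).
  by apply: savg_outside; rewrite (le_trans _ (ler_norm _))//; clear -h; lra.
have h2 : 2^-1 <= savg [:: x1, x2 & l] (outside 1) (0 - x3 - x4).
  by apply: L'; clear -h; lra.
rewrite !(savg_cons x1) !(savg_cons x2) in h1 h2 *.
have h3 : 2^-1 <= savg l (outside 1) (0 + x3 - x4 + x1 + x2).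
  by apply: L; clear -p4 o3 o2 o1 h; lra.
have h4 : 2^-1 <= savg l (outside 1) (0 + x3 - x4 - x1 - x2).
  by apply: L'; clear -p4 o3 o2 o1 h; lra.
have h5 : 2^-1 <= savg l (outside 1) (0 - x3 + x4 + x1 + x2).
  by apply: L; clear -p4 o3 o2 o1 h; lra.
have h6 : 2^-1 <= savg l (outside 1) (0 - x3 + x4 - x1 - x2).
  by apply: L'; clear -p4 o3 o2 o1 h; lra.
have g1 := P (0 + x3 - x4 + x1 - x2); have g2 := P (0 + x3 - x4 - x1 + x2).
have g3 := P (0 - x3 + x4 + x1 - x2); have g4 := P (0 - x3 + x4 - x1 + x2).
clear -h1 h2 h3 h4 h5 h6 g1 g2 g3 g4; lra.
Qed.

Lemma savg_hold3 x y z l f :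
  savg l (hold x (hold y (hold z f))) =1 savg [:: x, y, z & l] f.
Proof. by move=> s; rewrite savg_hold !savg_cons !savg_hold2. Qed.

Definition tripleheld x y z : R -> R := hold x (pairheld y z).

Lemma tripleheldN x y z s : tripleheld x y z (- s) = tripleheld x y z s.
Proof. by apply: holdN => u; exact: pairheldN. Qed.

Lemma tripleheld_norm x y z s : tripleheld x y z `|s| = tripleheld x y z s.
Proof. by have [_|_] := ler0P s => //; rewrite tripleheldN. Qed.

Lemma tripleheldE x y z s : tripleheld x y z s =
  (outside 1 (s + x + y + z) + outside 1 (s + x + y - z) +
   outside 1 (s + x - y + z) + outside 1 (s + x - y - z) +
   (outside 1 (s - x + y + z) + outside 1 (s - x + y - z) +
   outside 1 (s - x - y + z) + outside 1 (s - x - y - z))) / 8.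
Proof. by rewrite /tripleheld {1}/hold !pairheldE; field. Qed.

Lemma savg_tripleheld_ge x y z l s : 1 <= `|s| -> 2^-1 <= savg l (tripleheld x y z) s.
Proof. by move=> s1; rewrite savg_hold3; exact: savg_outside. Qed.

(** For [s] nonnegative, [s + x + y + z] is outside; the second of the eight patterns is all minus
    when [s] is small and [x + y - z] when it is large. *)
Lemma tripleheld_ge_quarter x y z s : 1/2 < z -> z <= y -> y <= x ->
  4^-1 <= tripleheld x y z s.
Proof.
move=> z1 zy yx; rewrite -tripleheld_norm; have := normr_ge0 s; move: `|s| => {}s s0.
rewrite tripleheldE (@outside_pos _ 1 (s + x + y + z)); last by lra.
have h1 := outside_ge0 1 (s + x + y - z); have h2 := outside_ge0 1 (s + x - y + z).
have h3 := outside_ge0 1 (s + x - y - z); have h4 := outside_ge0 1 (s - x + y + z).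
have h5 := outside_ge0 1 (s - x + y - z); have h6 := outside_ge0 1 (s - x - y + z).
have h7 := outside_ge0 1 (s - x - y - z).
have [c|c] := leP s (x + y + z - 1).
  by rewrite (@outside_neg _ 1 (s - x - y - z)); lra.
by rewrite (@outside_pos _ 1 (s + x + y - z)); lra.
Qed.

Lemma tripleheld_ge_half x y z s : 1/2 < z -> z <= y -> y <= x ->
  1 - x + y - z <= `|s| -> 2^-1 <= tripleheld x y z s.
Proof.
move=> z1 zy yx; rewrite -tripleheld_norm; have := normr_ge0 s.
move: `|s| => {}s s0 sp.
rewrite tripleheldE (@outside_pos _ 1 (s + x + y + z)); last by lra.
rewrite (@outside_pos _ 1 (s + x + y - z)); last by lra.
rewrite (@outside_pos _ 1 (s + x - y + z)); last by lra.
have h3 := outside_ge0 1 (s + x - y - z); have h4 := outside_ge0 1 (s - x + y + z).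
have h5 := outside_ge0 1 (s - x + y - z); have h6 := outside_ge0 1 (s - x - y + z).
have h7 := outside_ge0 1 (s - x - y - z).
have [c|c] := leP s (x + y + z - 1).
  by rewrite (@outside_neg _ 1 (s - x - y - z)); lra.
by rewrite (@outside_pos _ 1 (s - x + y + z)); lra.
Qed.

Lemma tripleheld_ge_outside x y z s : 1/2 < z -> z <= y -> y <= x ->
  1/4 + 1/4 * outside (1 - x + y - z) s <= tripleheld x y z s.
Proof.
move=> z1 zy yx; rewrite {1}/outside; case: (leP (1 - x + y - z) `|s|) => h /=.
  by have := tripleheld_ge_half z1 zy yx h; lra.
by have := tripleheld_ge_quarter s z1 zy yx; lra.
Qed.

(** The target arises as 3/8 = 1/4 + 1/4 * 1/2: it remains to see the walk of the other weights end
    beyond the smaller threshold half of the time. *)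
Lemma savg_triple_of_outside x y z l : 1/2 < z -> z <= y -> y <= x ->
  2^-1 <= savg l (outside (1 - x + y - z)) 0 ->
  3/8 <= savg [:: x, y, z & l] (outside 1) 0.
Proof.
move=> z1 zy yx h; rewrite -savg_hold3.
apply: (@le_trans _ _ (savg l (fun s => 1/4 + 1/4 * outside (1 - x + y - z) s) 0)).
  by rewrite savg_lin; move: h; set w := savg _ _ _; clear; lra.
by apply: le_savg => s; exact: tripleheld_ge_outside.
Qed.

(* The squared trigonometric polynomial [(7/10 + cos (t s))^2] concentrates
   on [|s| < p] when [t p = 65/100]. *)
Lemma savg_outside_small p l : 0 < p -> p < 29/100 ->
  (forall u, u \in l -> 0 <= u <= p) -> 4 * p - 3/2 * p ^+ 2 <= sumsq l ->
  2^-1 <= savg l (outside p) 0.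
Proof.
move=> p0 p1 hl hs.
pose t : R := 65/100/p.
have tp : t * p = 65/100 by rewrite /t; clear -p0; field; rewrite gt_eqF.
have t2 : 224/100 <= t by clear -tp p0 p1; nra.
have t0 : 0 <= t by clear -t2; lra.
clearbody t.
pose g s := 99/100 + 14/10 * cos (t * s) + 1/2 * cos (2 * t * s).
have gE s : g s = (7/10 + cos (t * s)) ^+ 2.
  rewrite /g -(mulrA 2) (_ : 2 * (t * s) = t * s + t * s); last by ring.
  rewrite cosD -expr2; have := cos2Dsin2 (t * s).
  move: (cos _) (sin _) => c d cd.
  by rewrite -expr2 (_ : d ^+ 2 = 1 - c ^+ 2); [field | rewrite -cd addrC addKr].
(* Inside, the cosine is at least 796/1000, and 1119/500 is just below the square of 7/10 +
   796/1000. *)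
have gout s : 1 + (- (500/1119)) * g s <= outside p s.
  rewrite gE {1}/outside; case: (leP p `|s|) => h /=.
    by have := sqr_ge0 (7/10 + cos (t * s)); clear; lra.
  have h1 : (t * s) ^+ 2 <= 4225/10000.
    have -> : (t * s) ^+ 2 = (t * `|s|) ^+ 2 by rewrite !exprMn real_normK ?num_real.
    have -> : 4225/10000 = (t * p) ^+ 2 by rewrite tp; clear; lra.
    by rewrite lerXn2r ?nnegrE ?mulr_ge0 ?ler_wpM2l// ltW.
  have := cos_ge_of_sqr h1; move: (cos _) => c; clear => hc.
  have {}hc : 796/1000 <= c by move: hc; clear; lra.
  by clear -hc; nra.
have rate : 259/100 <= t ^+ 2 / 2 * (4 * p - 3/2 * p ^+ 2).
  have -> : t ^+ 2 / 2 * (4 * p - 3/2 * p ^+ 2) = 2 * t * (t * p) - 3/4 * (t * p) ^+ 2.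
    by field.
  by rewrite tp; clear -t2; lra.
have e1 : cosprod t l <= 8/100.
  apply: (@cosprod_le_pow _ 7 t (4 * p - 3/2 * p ^+ 2) (37/100) (6908/10000)).
  - exact: t0.
  - move=> u /hl/andP[-> h]; split => //.
    by apply: (@le_trans _ _ (t * p)); [rewrite ler_wpM2l | rewrite tp; clear; lra].
  - exact: hs.
  - by clear; lra.
  - by apply: le_trans rate; clear; lra.
  - by clear; lra.
  - by clear; lra.
have e2 : cosprod (2 * t) l <= 1/1000.
  apply: (@cosprod_le_pow _ 10 (2 * t) (4 * p - 3/2 * p ^+ 2) 1 (375/1000)).
  - by rewrite mulr_ge0.
  - move=> u /hl/andP[-> h]; split => //.
    rewrite -mulrA; apply: (@le_trans _ _ (2 * (t * p))); last by rewrite tp; clear; lra.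
    by rewrite ler_wpM2l// ler_wpM2l.
  - exact: hs.
  - by clear; lra.
  - by move: rate; rewrite exprMn; move: (t ^+ 2) (4 * p - _) => u v; clear; lra.
  - by clear; lra.
  - by clear; lra.
apply: le_trans (le_savg l gout 0); rewrite savg_lin.
have -> : savg l g 0 = 99/100 + 14/10 * cosprod t l + 1/2 * cosprod (2 * t) l.
  rewrite /g savg_add (savg_lin (99/100)) savg_cos.
  have -> : savg l (fun s => 1/2 * cos (2 * t * s)) 0 =
            savg l (fun s => 0 + 1/2 * cos (2 * t * s)) 0.
    by apply: eq_savg => s; rewrite add0r.
  by rewrite savg_lin savg_cos !cosavg0 add0r.
by clear -e1 e2; lra.
Qed.

(** The terminal deficit is 1/4, and only on [|s| < p], where [2 * r] bounds the cosine from below.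
    Since [r] also bounds the cosine product, the loss is at most 1/8. The quadratic in [t] comes
    from substituting [t * p = 157/100 - t] in the Gaussian exponent. *)
Lemma savg_triple_cos x y z p l t0 z0 q r t : 1/2 < z -> z <= y -> y <= x ->
  p = 1 - x + y - z -> t * (1 + p) = 157/100 -> 0 <= p ->
  (forall u, u \in l -> 0 <= u <= p) -> 4 * p - 3/2 * p ^+ 2 <= sumsq l ->
  0 <= t0 -> t0 <= t -> 0 <= z0 ->
  4 * z0 <= (- (11/2) * t ^+ 2 + 1099/100 * t - 37/10 + 26/10000) / 2 ->
  1 - z0 + z0^+2/2 - z0^+3/6 + z0^+4/24 <= q -> q ^+ 4 <= r ->
  2 * r <= 1 - (157/100 - t0) ^+ 2 / 2 -> 0 < r ->
  3/8 <= savg [:: x, y, z & l] (outside 1) 0.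
Proof.
move=> z1 zy yx pE tp p0 hl hs t00 tt0 z00 hz hq hr hK r0.
have t_ge0 : 0 <= t by exact: le_trans tt0.
have tp' : t * p = 157/100 - t by rewrite -tp; ring.
pose K := 2 * r.
have K0 : 0 < K by rewrite /K mulr_gt0.
have hU : forall s, `|s| < 1 -> 2^-1 - 1/4/K * cos (t * s) <= tripleheld x y z s.
  move=> s s1; have [sp|sp] := leP p `|s|.
    apply: (@le_trans _ _ 2^-1); last by apply: tripleheld_ge_half => //; rewrite -pE.
    rewrite gerBl mulr_ge0//; first by rewrite divr_ge0// ltW.
    rewrite -cos_norm; apply: cos_ge0_157; first by rewrite mulr_ge0.
    by rewrite -tp ler_wpM2l// (le_trans (ltW s1))// lerDl.
  apply: le_trans (tripleheld_ge_quarter s z1 zy yx).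
  have hc : K <= cos (t * s).
    apply: (le_trans hK); rewrite -cos_norm.
    have ts0 : 0 <= t * `|s| by rewrite mulr_ge0.
    apply: le_trans (cos_ge_taylor2 ts0).
    have h1 : t * `|s| <= 157/100 - t0.
      apply: (@le_trans _ _ (t * p)); first by rewrite ler_wpM2l// ltW.
      by rewrite tp' lerD2l lerN2.
    by move: (t * _) ts0 h1 => u; clear; nra.
  have : 1/4 <= 1/4/K * cos (t * s).
    by rewrite mulrAC ler_pdivlMr// ler_wpM2l.
  by move: (_ * cos _) => u; clear; lra.
have h0 : `|0 : R| <= 1 + p by rewrite normr0 addr_ge0.
have key : 2^-1 - 1/4/K * cosavg t l 0 <= savg l (tripleheld x y z) 0.
  apply: (@savg_ge_cos _ t p) => [| | | |l' s'||].
  - exact: t_ge0.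
  - by rewrite divr_ge0// ltW.
  - by rewrite tp.
  - exact: hU.
  - exact: savg_tripleheld_ge.
  - exact: hl.
  - exact: h0.
rewrite savg_hold3 !cosavg0 in key; apply: le_trans key.
have e1 : cosprod t l <= r.
  apply: (@cosprod_le_pow _ 4 t (4 * p - 3/2 * p ^+ 2) z0 q) => //.
    move=> u /hl/andP[-> h]; split => //.
    by rewrite -tp ler_wpM2l// (le_trans h)// lerDr.
  apply: (le_trans hz).
  have -> : t ^+ 2 / 2 * (4 * p - 3/2 * p ^+ 2) = 2 * t * (t * p) - 3/4 * (t * p) ^+ 2.
    by field.
  by rewrite tp'; clear; lra.
have : 1/4/K * cosprod t l <= 1/8.
  have -> : 1/8 = 1/4/K * r by rewrite /K; clear -r0; field; rewrite gt_eqF.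
  by rewrite ler_wpM2l// divr_ge0// ltW.
by move: (_ * cosprod _ _) => u; clear; lra.
Qed.

Lemma savg_triple_middle x y z p l : 1/2 < z -> z <= y -> y <= x ->
  p = 1 - x + y - z -> 29/100 <= p -> p <= 1/2 ->
  (forall u, u \in l -> 0 <= u <= p) -> 4 * p - 3/2 * p ^+ 2 <= sumsq l ->
  3/8 <= savg [:: x, y, z & l] (outside 1) 0.
Proof.
move=> z1 zy yx pE pl pu hl hs.
pose t : R := 157/100/(1 + p).
have p1 : 0 < 1 + p by clear -pl; lra.
have p0 : 0 <= p by clear -pl; lra.
have tp : t * (1 + p) = 157/100 by rewrite /t; clear -p1; field; rewrite gt_eqF.
clearbody t.
have tu : t <= 1218/1000 by clear -tp pl; nra.
have tl : 1046/1000 <= t by clear -tp pl pu; nra.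
have T := @savg_triple_cos x y z p l _ _ _ _ t z1 zy yx pE tp p0 hl hs.
(* The exponent is concave in [t], so on each of the four subintervals it is bounded below by its
   chord. *)
have chord (u v : R) : u <= t -> t <= v -> 0 <= (t - u) * (v - t).
  by move=> ut tv; rewrite mulr_ge0 ?subr_ge0.
have [c1|/ltW c1] := leP (1205/1000) t.
  have h := chord _ _ c1 tu.
  apply: (T (1205/1000) (1911/10000) (8261/10000) (466/1000)).
  - by clear; lra.
  - exact: c1.
  - by clear; lra.
  - by move: h; clear -c1 tu => h; lra.
  - by clear; lra.
  - by clear; lra.
  - by clear; lra.
  - by clear; lra.
have [c2|/ltW c2] := leP (1170/1000) t.
  have h := chord _ _ c2 c1.
  apply: (T (1170/1000) (1949/10000) (8230/10000) (459/1000)).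
  - by clear; lra.
  - exact: c2.
  - by clear; lra.
  - by move: h; clear -c1 c2 => h; lra.
  - by clear; lra.
  - by clear; lra.
  - by clear; lra.
  - by clear; lra.
have [c3|/ltW c3] := leP (1110/1000) t.
  have h := chord _ _ c3 c2.
  apply: (T (1110/1000) (2039/10000) (8156/10000) (443/1000)).
  - by clear; lra.
  - exact: c3.
  - by clear; lra.
  - by move: h; clear -c2 c3 => h; lra.
  - by clear; lra.
  - by clear; lra.
  - by clear; lra.
  - by clear; lra.
have h := chord _ _ tl c3.
apply: (T (1046/1000) (2155/10000) (8062/10000) (423/1000)).
- by clear; lra.
- exact: tl.
- by clear; lra.
- by move: h; clear -c3 tl => h; lra.
- by clear; lra.
- by clear; lra.
- by clear; lra.
- by clear; lra.
Qed.

Lemma savg_three_large x y z w l :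
  1/2 < z -> z <= y -> y <= x -> x < 1 -> 0 <= w -> w <= z ->
  (forall u, u \in l -> 0 <= u <= w) ->
  x ^+ 2 + y ^+ 2 + z ^+ 2 + sumsq (w :: l) = 3 ->
  3/8 <= savg [:: x, y, z, w & l] (outside 1) 0.
Proof.
move=> z1 zy yx x1 w0 wz hl hs.
have [c1|c1] := leP 1 (z + w).
  by apply: savg_four_large.
have [c2|c2] := leP 1 (x + y - z).
  rewrite savg_rot3; apply: savg_three_moves => //.
  - by clear -z1 zy yx; lra.
  - by clear -z1; lra.
  - exact: le_trans yx.
  - by clear -z1 zy; lra.
pose p := 1 - x + y - z.
have pE : p = 1 - x + y - z by [].
(* When [p <= w], the single step [w] already reaches the threshold, and reflection gives one
   half. *)
have [c3|c3] := leP p w.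
  apply: savg_triple_of_outside => //.
  have h1 : 2^-1 <= savg l (outside p) (0 + w).
    by apply: savg_outside; rewrite add0r (le_trans c3)// ler_norm.
  have h2 : 2^-1 <= savg l (outside p) (0 - w).
    by apply: savg_outside; rewrite sub0r normrN (le_trans c3)// ler_norm.
  by rewrite savg_cons -pE; clear -h1 h2; lra.
have hl' u : u \in w :: l -> 0 <= u <= p.
  rewrite inE => /predU1P[->|/hl/andP[-> /= uw]]; first by rewrite w0 ltW.
  by rewrite (le_trans uw) ?ltW.
have p0 : 0 < p by rewrite pE; clear -c2 zy; lra.
have pu : p <= 1/2 by rewrite pE; clear -z1 zy yx; lra.
(* The right bounds are [1 - p/2] for [x] and [y] and [1 - p] for [z]; 3 minus their squares is
   exactly the left side. *)
have hs' : 4 * p - 3/2 * p ^+ 2 <= sumsq (w :: l).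
  have xb : x <= 1 - p / 2 by rewrite pE; clear -c2; lra.
  have yb : y <= 1 - p / 2 by apply: le_trans xb.
  have zb : z <= 1 - p by rewrite pE; clear -yx; lra.
  have z0 : 0 <= z by clear -z1; lra.
  have y0 := le_trans z0 zy; have x0 := le_trans y0 yx.
  have xq : x ^+ 2 <= (1 - p / 2) ^+ 2 by rewrite lerXn2r ?nnegrE// (le_trans x0).
  have yq : y ^+ 2 <= (1 - p / 2) ^+ 2 by rewrite lerXn2r ?nnegrE// (le_trans y0).
  have zq : z ^+ 2 <= (1 - p) ^+ 2 by rewrite lerXn2r ?nnegrE// (le_trans z0).
  clearbody p; clear -xq yq zq hs; lra.
have [c4|c4] := ltP p (29/100).
  by apply: savg_triple_of_outside => //; apply: savg_outside_small.
exact: (@savg_triple_middle _ _ _ p).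
Qed.

End TripleHeld.

(** * Second weight close to one half *)

Section SingleHeld.
Variable R : realType.
Implicit Types (s t a b c d e x y z r G K : R) (l k : seq R).

Lemma hold_outsideN b s : hold b (outside 1) (- s) = hold b (outside 1) s.
Proof. by apply: holdN => u; exact: outsideN. Qed.

Lemma hold_outside_ge0 b s : 0 <= hold b (outside 1) s.
Proof. by rewrite /hold divr_ge0// addr_ge0// outside_ge0. Qed.

Lemma hold_outside_ge_half b s : 1 - b <= `|s| -> 2^-1 <= hold b (outside 1) s.
Proof.
have -> : hold b (outside 1) s = hold b (outside 1) `|s|.
  by have [_|_] := ler0P s => //; rewrite hold_outsideN.
move: `|s| => {}s h; rewrite /hold outside_pos; last by lra.
by have := outside_ge0 1 (s - b); lra.
Qed.

Lemma savg_hold_outside_ge b l s : 1 <= `|s| -> 2^-1 <= savg l (hold b (outside 1)) s.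
Proof. by move=> s1; rewrite savg_hold; exact: savg_outside. Qed.

(** The terminal function is at least 1/2 from [1 - b] on, so the scaled cosine has to reach 1/2
    only on the shorter interval. *)
Lemma hold_outside_deficit t b K s : 0 <= t -> t <= 157/100 -> 0 < K ->
  (`|s| <= 1 - b -> K <= cos (t * s)) -> `|s| < 1 ->
  2^-1 - 1/2/K * cos (t * s) <= hold b (outside 1) s.
Proof.
move=> t0 t1 K0 hK s1.
have [sb|sb] := leP (1 - b) `|s|.
  apply: le_trans (hold_outside_ge_half sb).
  rewrite gerBl mulr_ge0//; first by rewrite divr_ge0// ltW.
  rewrite -cos_norm cos_ge0_157// ?mulr_ge0//.
  by apply: le_trans t1; rewrite ler_piMr// ltW.
apply: le_trans (hold_outside_ge0 b s).
have {}hK := hK (ltW sb).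
have : 1/2 <= 1/2/K * cos (t * s).
  by rewrite mulrAC ler_pdivlMr// ler_wpM2l.
by move: (_ * cos _) => u; clear; lra.
Qed.

(* Degree-six Taylor bound with [e^4] replaced by its tangent at [e^2 = 1/4]. *)
Lemma cos_ge_near_half x c e : 0 <= c -> x ^+ 2 <= c * e ^+ 2 -> c * e ^+ 2 <= 33/100 ->
  1 - c * e ^+ 2 / 2 + c ^+ 2 * (e ^+ 2 / 2 - 1/16) / 24 - 1/2000/10 <= cos x.
Proof.
move=> c0 xz z1; apply: le_trans (cos_ge_of_sqr xz).
have h1 : 0 <= c ^+ 2 * (e ^+ 2 - 1/4) ^+ 2 by rewrite mulr_ge0 ?sqr_ge0.
have h2 : (c * e ^+ 2) ^+ 3 <= 36/1000.
  apply: (@le_trans _ _ ((33/100) ^+ 3)); last by clear; lra.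
  by rewrite lerXn2r ?nnegrE// mulr_ge0 ?sqr_ge0.
have -> : (c * e ^+ 2) ^+ 2 = c ^+ 2 * (e ^+ 2 - 1/4) ^+ 2 + c ^+ 2 * (e ^+ 2 / 2 - 1/16).
  by field.
move: ((c * e ^+ 2) ^+ 3) (c ^+ 2 * (e ^+ 2 - 1 / 4) ^+ 2) (c * e ^+ 2) h1 h2 => u v w.
by move: (c ^+ 2 * _) => p; clear; lra.
Qed.

(** The tangent-line factor moves the exponent to the centre 1/4 of the squared weight, so that [b]
    survives only polynomially. *)
Lemma expR_recentre a b :
  expR (- (a * (3 - b ^+ 2))) * (1 - a * (b ^+ 2 - 1/4)) <= expR (- (a * (11/4))).
Proof.
apply: (@le_trans _ _ (expR (- (a * (3 - b ^+ 2))) * expR (- (a * (b ^+ 2 - 1/4))))).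
  by rewrite ler_wpM2l ?expR_ge0// expR_ge1Dx.
rewrite -expRD (_ : - (a * (3 - b ^+ 2)) - a * (b ^+ 2 - 1/4) = - (a * (11/4)))//.
by field.
Qed.

(** The Gaussian bound is not sharp for sizeable weights: each weight in [k] improves it by the
    factor [G]. *)
Lemma cosprod_le_gain t G x0 x1 k l : 0 <= t -> 0 <= G ->
  (forall x, x \in k -> x0 <= x <= x1) -> 0 <= x0 -> t * x1 <= 157/100 ->
  (forall x, x0 <= x -> x <= x1 -> cos (t * x) <= G * expR (- (t ^+ 2 / 2 * x ^+ 2))) ->
  (forall x, x \in l -> 0 <= x /\ t * x <= 157/100) ->
  cosprod t (k ++ l) <= G ^+ size k * expR (- (t ^+ 2 / 2 * sumsq (k ++ l))).
Proof.
move=> t0 G0 hk x00 tx1 hG hl; elim: k hk => [_|x k IH hk].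
  by rewrite expr0 mul1r cosprod_le.
have /andP[xa xb] := hk x (mem_head _ _).
have hk' y : y \in k -> x0 <= y <= x1 by move=> yk; apply: hk; rewrite inE yk orbT.
have p0 y : x0 <= y -> y <= x1 -> 0 <= y /\ t * y <= 157/100.
  by move=> ya yb; rewrite (le_trans x00 ya) (le_trans _ tx1)// ler_wpM2l.
rewrite /= cosprod_cons sumsq_cons mulrDr opprD expRD exprS mulrACA.
have [q1 q2] := p0 x xa xb.
apply: ler_pM.
- by apply: cos_ge0_157 => //; rewrite mulr_ge0.
- apply: cosprod_ge0 => // y; rewrite mem_cat => /orP[/hk'/andP[? ?]|/hl//].
  exact: p0.
- exact: hG.
- exact: IH.
Qed.

End SingleHeld.

(** * Six weights of nearly the same size *)

Section MediumSecond.
Variable R : realType.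
Implicit Types (s t a b x y z : R) (l k : seq R).

Lemma savg_many_medium b k l :
  48/100 <= b -> b <= 52/100 -> size k = 5 ->
  (forall x, x \in k -> 48/100 <= x <= 1/2) ->
  (forall x, x \in l -> 0 <= x <= 1/2) ->
  b ^+ 2 + sumsq (k ++ l) = 3 -> 3/8 <= savg (b :: (k ++ l)) (outside 1) 0.
Proof.
move=> b0 b1 ks hk hl hs.
pose t : R := 157/150.
have t0 : 0 <= t by rewrite /t; clear; lra.
have t1 : t <= 157/100 by rewrite /t; clear; lra.
have t2u : t ^+ 2 <= 10956/10000 by rewrite /t; clear; lra.
have t2l : 10955/10000 <= t ^+ 2 by rewrite /t; clear; lra.
have tM : t * (1 + 1/2) <= 157/100 by rewrite /t; clear; lra.
have tM2 : t * (1/2) <= 157/100 by rewrite /t; clear; lra.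
clearbody t.
(* A linear lower bound, close to the tangent at [b = 1/2], for [cos (t * (1 - b))]. *)
pose K : R := 8653/10000 + 515/1000 * (b - 1/2).
have K0 : 0 < K by rewrite /K; clear -b0 b1; lra.
have hK s : `|s| <= 1 - b -> K <= cos (t * s).
  move=> sb.
  have h1 : (t * s) ^+ 2 <= 10956/10000 * (1 - b) ^+ 2.
    rewrite exprMn -(real_normK (num_real s)).
    apply: ler_pM; [exact: sqr_ge0|exact: sqr_ge0|exact: t2u|].
    by rewrite lerXn2r ?nnegrE// (le_trans _ sb).
  have h2 : 10956/10000 * (1 - b) ^+ 2 <= 33/100 by clear -b0 b1; nra.
  have h3 : (0 : R) <= 10956/10000 by clear; lra.
  apply: le_trans (cos_ge_near_half h3 h1 h2).
  by rewrite /K; clear -b0 b1; nra.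
have gain x : 48/100 <= x -> x <= 1/2 ->
    cos (t * x) <= 9945/10000 * expR (- (t ^+ 2 / 2 * x ^+ 2)).
  move=> xa xb.
  have tx0 : 0 <= t * x by rewrite mulr_ge0//; clear -xa; lra.
  have y0 : 0 <= t ^+ 2 / 2 * x ^+ 2 by rewrite mulr_ge0 ?divr_ge0 ?sqr_ge0.
  have h1 := expRN_ge_taylor3 y0; have h2 := cos_le_taylor4 tx0.
  have e2 : (t * x) ^+ 2 = 2 * (t ^+ 2 / 2 * x ^+ 2) by field.
  have e4 : (t * x) ^+ 4 = 4 * (t ^+ 2 / 2 * x ^+ 2) ^+ 2 by field.
  rewrite e2 e4 in h2.
  have ya : 126/1000 <= t ^+ 2 / 2 * x ^+ 2.
    have : 2304/10000 <= x ^+ 2 by clear -xa; nra.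
    by move: (t ^+ 2) (x ^+ 2) t2l => u v; clear; nra.
  have yb : t ^+ 2 / 2 * x ^+ 2 <= 138/1000.
    have : x ^+ 2 <= 1/4 by clear -xa xb; nra.
    by have := sqr_ge0 x; move: (t ^+ 2) (x ^+ 2) t2u t2l => u v; clear; nra.
  apply: (le_trans h2); move: (t ^+ 2 / 2 * x ^+ 2) (expR _) h1 ya yb => y w.
  clear => h1 ya yb.
  suff : 1 - 2 * y / 2 + 4 * y ^+ 2 / 24 <= 9945/10000 * (1 - y + y ^+ 2 / 2 - y ^+ 3 / 6).
    by move: h1; clear; lra.
  by clear -ya yb; nra.
have hl' x : x \in l -> 0 <= x /\ t * x <= 157/100.
  move=> /hl/andP[-> h]; split => //; apply: le_trans tM2.
  by rewrite ler_wpM2l.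
have X : cosprod t (k ++ l) <=
    (9945/10000) ^+ 5 * expR (- (t ^+ 2 / 2 * sumsq (k ++ l))).
  have g0 : (0 : R) <= 9945/10000 by clear; lra.
  have h48 : (0 : R) <= 48/100 by clear; lra.
  have := cosprod_le_gain t0 g0 hk h48 tM2 gain hl'; rewrite ks; exact.
have {}X : cosprod t (k ++ l) * (1 - t ^+ 2 / 2 * (b ^+ 2 - 1/4)) <=
    9729/10000 * (2220/10000).
  have hb : 0 <= 1 - t ^+ 2 / 2 * (b ^+ 2 - 1/4).
    have : b ^+ 2 <= 271/1000 by clear -b0 b1; nra.
    by move: (t ^+ 2) (b ^+ 2) t2l t2u => u v; clear; nra.
  apply: (le_trans (ler_wpM2r hb X)); rewrite -(mulrA _ (expR _)).
  have -> : sumsq (k ++ l) = 3 - b ^+ 2 by rewrite -hs addrC addKr.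
  apply: ler_pM; [by clear; lra|by rewrite mulr_ge0 ?expR_ge0|by clear; lra|].
  apply: le_trans (expR_recentre _ _) _.
  apply: (@expRN_le_pow _ 4 (3765/10000) (6864/10000)).
  - by clear; lra.
  - by move: (t ^+ 2) t2l => u; clear; lra.
  - by clear; lra.
  - by clear; lra.
(* Multiplying by the positive recentring factor leaves a polynomial inequality in [b - 1/2]. *)
have fin : 4 * cosprod t (k ++ l) <= K.
  have hb : 0 < 1 - t ^+ 2 / 2 * (b ^+ 2 - 1/4).
    have : b ^+ 2 <= 271/1000 by clear -b0 b1; nra.
    by move: (t ^+ 2) (b ^+ 2) t2l t2u => u v; clear; nra.
  rewrite -(ler_pM2r hb) -(mulrA 4).
  apply: (@le_trans _ _ (4 * (9729/10000 * (2220/10000)))); first by rewrite ler_wpM2l.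
  rewrite /K.
  have q : t ^+ 2 / 2 * (b ^+ 2 - 1/4) <=
      5478/10000 * (b - 1/2 + (b - 1/2) ^+ 2) + 1/2000/10.
    by move: (t ^+ 2) t2l t2u => u; clear -b0 b1; nra.
  apply: (@le_trans _ _ ((8653/10000 + 515/1000 * (b - 1/2)) *
    (1 - (5478/10000 * (b - 1/2 + (b - 1/2) ^+ 2) + 1/2000/10)))).
    have d1 : b - 1/2 <= 2/100 by clear -b1; lra.
    have d0 : - (2/100) <= b - 1/2 by clear -b0; lra.
    move: (b - 1/2) d0 d1 => d d0 d1; clear -d0 d1.
    have h1 : 0 <= (d + 2/100) * (2/100 - d) by apply: mulr_ge0; lra.
    have h2 : 0 <= d ^+ 2 * (2/100 - d) by apply: mulr_ge0; [exact: sqr_ge0|lra].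
    by lra.
  apply: ler_wpM2l; first exact: (ltW K0).
  by move: q; move: (t ^+ 2 / 2 * _) => u; clear; lra.
have h0 : `|0 : R| <= 1 + 1/2 by rewrite normr0; clear; lra.
have key : 2^-1 - 1/2/K * cosavg t (k ++ l) 0 <= savg (k ++ l) (hold b (outside 1)) 0.
  apply: (@savg_ge_cos _ t (1/2)) => [| | | |l' s'||].
  - exact: t0.
  - by rewrite divr_ge0// ltW.
  - exact: tM.
  - by move=> s s1; apply: hold_outside_deficit => //; exact: hK.
  - exact: savg_hold_outside_ge.
  - move=> x; rewrite mem_cat => /orP[/hk/andP[h ->]|/hl//].
    by rewrite andbT (le_trans _ h)//; clear; lra.
  - exact: h0.
rewrite savg_hold cosavg0 in key; apply: le_trans key.
have : 1/2/K * cosprod t (k ++ l) <= 1/8.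
  by rewrite mulrAC ler_pdivrMr//; clear -fin; lra.
by move: (_ * cosprod _ _) => u; clear; lra.
Qed.

End MediumSecond.

(** * Second weight close to one half, sixth weight at most 48/100 *)

Section MediumSecondSmallSixth.
Variable R : realType.
Implicit Types (s t a b x y z : R) (l k : seq R).

(** By evenness the eight endpoints of three steps form four pairs of weight 1/4 each, so a loss [L]
    at the farthest pair costs only [L / 4]. *)
Lemma savg_cos_three_steps (F H : R -> R) C L x y z :
  (forall s, F (- s) = F s) -> (forall s, H (- s) = H s) ->
  2^-1 - C * H (x + y + z) - L <= F (x + y + z) ->
  2^-1 - C * H (x + y - z) <= F (x + y - z) ->
  2^-1 - C * H (x - y + z) <= F (x - y + z) ->
  2^-1 - C * H (x - y - z) <= F (x - y - z) ->
  2^-1 - C * hold x (hold y (hold z H)) 0 - L / 4 <= hold x (hold y (hold z F)) 0.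
Proof.
move=> Fe He h1 h2 h3 h4; rewrite /hold !add0r.
have E (G : R -> R) : (forall s, G (- s) = G s) ->
  [/\ G (- x - y - z) = G (x + y + z), G (- x - y + z) = G (x + y - z),
      G (- x + y - z) = G (x - y + z) & G (- x + y + z) = G (x - y - z)].
  by move=> Ge; split; rewrite -Ge; congr G; ring.
have [-> -> -> ->] := E F Fe; have [-> -> -> ->] := E H He.
by clear -h1 h2 h3 h4; lra.
Qed.

(** The frequency is fitted to overshoot 48/100, although [x], [y], [z] and [w] may reach 1/2. Their
    steps are therefore unrolled, and the excess matters only at [x + y + z]. *)
Lemma savg_few_medium b x y z w l :
  47/100 <= b -> b <= 53/100 -> 0 <= w -> w <= z -> z <= y -> y <= x -> x <= 1/2 ->
  (forall u, u \in l -> 0 <= u <= 48/100) ->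
  b ^+ 2 + sumsq [:: x, y, z, w & l] = 3 ->
  3/8 <= savg [:: b, x, y, z, w & l] (outside 1) 0.
Proof.
move=> b0 b1 w0 wz zy yx x1 hl hs.
pose t : R := 157/148.
have t0 : 0 <= t by rewrite /t; clear; lra.
have t1 : t <= 157/100 by rewrite /t; clear; lra.
have t2u : t ^+ 2 <= 11254/10000 by rewrite /t; clear; lra.
have t2l : 11253/10000 <= t ^+ 2 by rewrite /t; clear; lra.
have tM : t * (1 + 48/100) <= 157/100 by rewrite /t; clear; lra.
have tM2 : t * (1/2) <= 157/100 by rewrite /t; clear; lra.
clearbody t.
have z0 := le_trans w0 wz; have y0 := le_trans z0 zy; have x0 := le_trans y0 yx.
pose K : R := 8617/10000 + 5365/10000 * (b - 1/2).
have K0 : 0 < K by rewrite /K; clear -b0 b1; lra.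
pose C := 1/2/K.
have C0 : 0 <= C by rewrite divr_ge0// ltW.
have hK s : `|s| <= 1 - b -> K <= cos (t * s).
  move=> sb.
  have h1 : (t * s) ^+ 2 <= 11254/10000 * (1 - b) ^+ 2.
    rewrite exprMn -(real_normK (num_real s)).
    apply: ler_pM; [exact: sqr_ge0|exact: sqr_ge0|exact: t2u|].
    by rewrite lerXn2r ?nnegrE// (le_trans _ sb).
  have h2 : 11254/10000 * (1 - b) ^+ 2 <= 33/100 by clear -b0 b1; nra.
  have h3 : (0 : R) <= 11254/10000 by clear; lra.
  apply: le_trans (cos_ge_near_half h3 h1 h2).
  by rewrite /K; clear -b0 b1; nra.
have hl' u : u \in w :: l -> 0 <= u /\ t * u <= 157/100.
  move=> ul; have /andP[u0 u1] : 0 <= u <= 1/2.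
    move: ul; rewrite inE => /predU1P[->|/hl/andP[-> h]].
      by rewrite w0; clear -wz zy yx x1; lra.
    by apply: le_trans h _; clear; lra.
  by split => //; apply: le_trans tM2; rewrite ler_wpM2l.
pose F := savg (w :: l) (hold b (outside 1)); pose H := cosavg t (w :: l).
pose P := cosprod t (w :: l).
have P0 : 0 <= P by exact: cosprod_ge0.
have FN s : F (- s) = F s by apply: savg_even; exact: hold_outsideN.
have HN s : H (- s) = H s by exact: cosavgN.
have tail s : `|s| <= 148/100 ->
    2^-1 - C * cosavg t l s <= savg l (hold b (outside 1)) s.
  move=> s1; apply: (@savg_ge_cos _ t (48/100)) => [| | | |l' s'||].
  - exact: t0.
  - exact: C0.
  - exact: tM.
  - by move=> {s1}s s1; apply: hold_outside_deficit => //; exact: hK.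
  - exact: savg_hold_outside_ge.
  - exact: hl.
  - by apply: (le_trans s1); clear; lra.
have H_ge s : `|s| <= 148/100 -> 0 <= H s.
  move=> s1; rewrite /H /cosavg mulr_ge0// -cos_norm cos_ge0_157 ?mulr_ge0//.
  apply: le_trans tM; rewrite ler_wpM2l//; apply: (le_trans s1); clear; lra.
have inside s : `|s| <= 1 -> (48/100 < w -> `|s| <= 98/100) -> 2^-1 - C * H s <= F s.
  move=> s1 s2.
  have s148 : `|s| <= 148/100 by apply: (le_trans s1); clear; lra.
  have step : `|s| + w <= 148/100 -> 2^-1 - C * H s <= F s.
    move=> sw; rewrite /H cosavg_cons /F savg_cons.
    have h1 : `|s + w| <= 148/100.
      by apply: le_trans (ler_normD _ _) _; rewrite (ger0_norm w0).
    have h2 : `|s - w| <= 148/100.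
      by apply: le_trans (ler_normB _ _) _; rewrite (ger0_norm w0).
    by have := tail _ h1; have := tail _ h2; clear; lra.
  apply: step; have [c|c] := leP w (48/100); first by clear -s1 c; lra.
  by have := s2 c; clear -wz zy yx x1; lra.
(* The endpoint may reach 3/2, where [t * s] slightly passes pi/2; the cosine is still at least
   -215/10000 there, and reflection bounds [F] by one half. *)
have far : 2^-1 - C * H (x + y + z) - C * (215/10000 * P) <= F (x + y + z).
  have c215 : (0 : R) <= 215/10000 by clear; lra.
  have loss : 0 <= C * (215/10000 * P) := mulr_ge0 C0 (mulr_ge0 c215 P0).
  have nn : `|x + y + z| = x + y + z by rewrite ger0_norm// !addr_ge0.
  have [c|c] := ltP (x + y + z) 1.
    have := inside (x + y + z); rewrite nn => h.
    apply: (@le_trans _ _ (2^-1 - C * H (x + y + z))); first by rewrite gerBl.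
    by apply: h; [exact: ltW | move=> w1; clear -c w1 wz zy yx; lra].
  have F2 : 2^-1 <= F (x + y + z) by apply: savg_hold_outside_ge; rewrite nn.
  apply: le_trans F2; rewrite -addrA -opprD gerBl -mulrDr.
  apply: mulr_ge0; first exact: C0.
  rewrite /H /cosavg -/P -mulrDl; apply: mulr_ge0; last exact: P0.
  have ss : (t * (x + y + z)) ^+ 2 <= 12661/5000.
    have : (x + y + z) ^+ 2 <= 9/4 by clear -x0 y0 z0 zy yx x1; nra.
    rewrite exprMn; have := sqr_ge0 (x + y + z).
    by move: (t ^+ 2) ((x + y + z) ^+ 2) t2u t2l => u v; clear; nra.
  by have := cos_ge_of_sqr ss; move: (cos _) => c'; clear; lra.
have mid s : - 1 <= s -> s <= 1 -> (48/100 < w -> - (98/100) <= s /\ s <= 98/100) ->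
    2^-1 - C * H s <= F s.
  move=> s1 s2 s3; apply: inside; first by rewrite ler_norml s1.
  by move=> /s3[s4 s5]; rewrite ler_norml s4.
have key : 2^-1 - C * cosprod t [:: x, y, z, w & l] - C * (215/10000 * P) / 4 <=
    savg [:: b, x, y, z, w & l] (outside 1) 0.
  rewrite -savg_hold -cosavg0.
  have -> : cosavg t [:: x, y, z, w & l] 0 = hold x (hold y (hold z H)) 0.
    by rewrite !(cosavg_cons t x) !(cosavg_cons t y) !(cosavg_cons t z).
  apply: savg_cos_three_steps; [exact: FN|exact: HN|exact: far| | |].
  - apply: mid => [||w1]; [by clear -w0 wz zy yx x1; lra..|].
    by clear -w1 wz zy yx x1; split; lra.
  - apply: mid => [||w1]; [by clear -w0 wz zy yx x1; lra..|].
    by clear -w1 wz zy yx x1; split; lra.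
  - apply: mid => [||w1]; [by clear -w0 wz zy yx x1; lra..|].
    by clear -w1 wz zy yx x1; split; lra.
apply: le_trans key.
have PU : P <= 3305/10000.
  apply: (@cosprod_le_pow _ 4 t (19691/10000) (2769/10000) (7582/10000)).
  - exact: t0.
  - exact: hl'.
  - move: hs; rewrite !(sumsq_cons x, sumsq_cons y, sumsq_cons z).
    move: (sumsq _) => S; clear -b0 b1 x0 y0 z0 zy yx x1 => hs.
    have hb : b ^+ 2 <= 2809/10000 by clear -b0 b1; nra.
    have hx : x ^+ 2 <= 1/4 by clear -x0 x1; nra.
    have hy : y ^+ 2 <= 1/4 by clear -y0 yx x1; nra.
    have hz : z ^+ 2 <= 1/4 by clear -z0 zy yx x1; nra.
    by clear -hs hb hx hy hz; lra.
  - by clear; lra.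
  - by move: (t ^+ 2) t2l => u; clear; lra.
  - by clear; lra.
  - by clear; lra.
set X := cosprod t _.
have hb : 0 < 1 - t ^+ 2 / 2 * (b ^+ 2 - 1/4).
  have : b ^+ 2 <= 281/1000 by clear -b0 b1; nra.
  by move: (t ^+ 2) (b ^+ 2) t2l t2u => u v; clear; nra.
have XU : X * (1 - t ^+ 2 / 2 * (b ^+ 2 - 1/4)) <= 2129/10000 + 4/10000/10.
  have XE : X <= expR (- (t ^+ 2 / 2 * (3 - b ^+ 2))).
    have -> : 3 - b ^+ 2 = sumsq [:: x, y, z, w & l] by rewrite -hs addrAC subrr add0r.
    apply: cosprod_le => // u; rewrite !inE => uin.
    have hu v : 0 <= v -> v <= 1/2 -> 0 <= v /\ t * v <= 157/100.
      by move=> v0 v1; split => //; apply: le_trans tM2; rewrite ler_wpM2l.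
    case/or4P: uin => [/eqP->|/eqP->|/eqP->|uin].
    - exact: hu.
    - by apply: hu => //; apply: le_trans x1.
    - by apply: hu => //; apply: le_trans x1; apply: le_trans yx.
    - by apply: hl'; rewrite inE.
  apply: (le_trans (ler_wpM2r (ltW hb) XE)).
  apply: le_trans (expR_recentre _ _) _.
  apply: (@expRN_le_pow _ 4 (3868/10000) (6793/10000)).
  - by clear; lra.
  - by move: (t ^+ 2) t2l => u; clear; lra.
  - by clear; lra.
  - by clear; lra.
have fin : 4 * X + 215/10000 * P <= K.
  suff : 4 * X <= K - 711/10000/10.
    by move: PU; clear; lra.
  rewrite -(ler_pM2r hb) -(mulrA 4).
  apply: (@le_trans _ _ (4 * (2129/10000 + 4/10000/10))); first by rewrite ler_wpM2l.
  rewrite /K.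
  have q : t ^+ 2 / 2 * (b ^+ 2 - 1/4) <=
      (5626/10000 + 6/10000/10) * (b - 1/2 + (b - 1/2) ^+ 2) + 1/2000/10.
    by move: (t ^+ 2) t2l t2u => u; clear -b0 b1; nra.
  apply: (@le_trans _ _ ((8617/10000 + 5365/10000 * (b - 1/2) - 711/10000/10) *
    (1 - ((5626/10000 + 6/10000/10) * (b - 1/2 + (b - 1/2) ^+ 2) + 1/2000/10)))).
    have d1 : b - 1/2 <= 3/100 by clear -b1; lra.
    have d0 : - (3/100) <= b - 1/2 by clear -b0; lra.
    move: (b - 1/2) d0 d1 => d d0 d1; clear -d0 d1.
    have h1 : 0 <= (d + 3/100) * (3/100 - d) by apply: mulr_ge0; lra.
    have h2 : 0 <= d ^+ 2 * (3/100 - d) by apply: mulr_ge0; [exact: sqr_ge0|lra].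
    by lra.
  apply: ler_wpM2l; first by clear -b0 b1; lra.
  by move: q; move: (t ^+ 2 / 2 * _) => u; clear; lra.
have : C * (4 * X + 215/10000 * P) <= 1/2.
  by rewrite /C mulrAC ler_pdivrMr//; clear -fin; lra.
by clear; lra.
Qed.

End MediumSecondSmallSixth.

(** * Nonincreasing weights *)

Section SignedSequences.
Variable R : realType.
Implicit Types (x : R) (l : seq R).

Lemma savg_six x1 x2 x3 x4 x5 x6 l :
  x2 <= x1 -> x3 <= x2 -> x4 <= x3 -> x5 <= x4 -> x6 <= x5 -> 0 <= x6 ->
  (forall u, u \in l -> 0 <= u <= x6) ->
  sumsq [:: x1, x2, x3, x4, x5, x6 & l] = 3 ->
  3/8 <= savg [:: x1, x2, x3, x4, x5, x6 & l] (outside 1) 0.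
Proof.
move=> o1 o2 o3 o4 o5 p6 hl hs.
have p5 := le_trans p6 o5; have p4 := le_trans p5 o4; have p3 := le_trans p4 o3.
have p2 := le_trans p3 o2; have p1 := le_trans p2 o1.
have hl6 u : u \in x6 :: l -> 0 <= u <= x6.
  by rewrite inE => /predU1P[->|/hl//]; rewrite p6 lexx.
have hl5 u : u \in [:: x5, x6 & l] -> 0 <= u <= x5.
  rewrite inE => /predU1P[->|/hl6/andP[-> /= h]]; first by rewrite p5 lexx.
  exact: le_trans o5.
have hl4 u : u \in [:: x4, x5, x6 & l] -> 0 <= u <= x4.
  rewrite inE => /predU1P[->|/hl5/andP[-> /= h]]; first by rewrite p4 lexx.
  exact: le_trans o4.
have hl3 u : u \in [:: x3, x4, x5, x6 & l] -> 0 <= u <= x3.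
  rewrite inE => /predU1P[->|/hl4/andP[-> /= h]]; first by rewrite p3 lexx.
  exact: le_trans o3.
have hl2 u : u \in [:: x2, x3, x4, x5, x6 & l] -> 0 <= u <= x2.
  rewrite inE => /predU1P[->|/hl3/andP[-> /= h]]; first by rewrite p2 lexx.
  exact: le_trans o2.
have [c1|c1] := leP 1 x1.
  rewrite savg_cons.
  have h1 : 2^-1 <= savg [:: x2, x3, x4, x5, x6 & l] (outside 1) (0 + x1).
    by apply: savg_outside; rewrite add0r (le_trans c1)// ler_norm.
  have h2 : 2^-1 <= savg [:: x2, x3, x4, x5, x6 & l] (outside 1) (0 - x1).
    by apply: savg_outside; rewrite sub0r normrN (le_trans c1)// ler_norm.
  by clear -h1 h2; lra.
have [c2|c2] := leP x2 (47/100).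
  apply: savg_small_second => //; last by rewrite -sumsq_cons.
  by move=> u /hl2/andP[-> h]; exact: le_trans c2.
have [c3|c3] := leP 1 (x1 + x2).
  have [c4|c4] := leP x3 (1/2).
    apply: savg_pair_half => // [u /hl4/andP[-> h]|]; first exact: le_trans o3.
    by rewrite -addrA -!sumsq_cons.
  apply: savg_three_large => // [u /hl5/andP[-> h]|]; first exact: le_trans o4.
  by rewrite -!addrA -!sumsq_cons.
have [c4|c4] := leP x6 (48/100).
  apply: savg_few_medium.
  - by clear -c2 o1; lra.
  - by clear -c3 c2; lra.
  - exact: p5.
  - exact: o4.
  - exact: o3.
  - exact: o2.
  - by clear -c3 o1; lra.
  - by move=> u /hl6/andP[-> h]; exact: le_trans c4.
  - by rewrite -sumsq_cons.
apply: (@savg_many_medium _ x1 [:: x2; x3; x4; x5; x6] l).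
- by clear -c4 o5 o4 o3 o2 o1; lra.
- by clear -c3 c4 o5 o4 o3 o2; lra.
- by [].
- have h2 : x2 <= 1/2 by clear -c3 o1; lra.
  move=> u; rewrite !inE => uin.
  have : x6 <= u <= x2.
    by case/or4P: uin => [/eqP->|/eqP->|/eqP->|/orP[]/eqP->];
      clear -o5 o4 o3 o2; apply/andP; split; lra.
  by move=> /andP[h3 h4]; apply/andP; split; [apply/ltW/(lt_le_trans c4)|apply: le_trans h2].
- move=> u /hl/andP[-> h]; apply: (le_trans h).
  by clear -c3 o1 o2 o3 o4 o5; lra.
- by rewrite -sumsq_cons.
Qed.

Lemma savg_antitone (b : nat -> R) n :
  (forall i j, (i <= j)%N -> b j <= b i) -> (forall i, 0 <= b i) ->
  sumsq (mkseq b (6 + n)) = 3 -> 3/8 <= savg (mkseq b (6 + n)) (outside 1) 0.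
Proof.
move=> ba b0 hs.
apply: (@savg_six (b 0%N) (b 1%N) (b 2%N) (b 3%N) (b 4%N) (b 5%N) (map b (iota 6 n)));
  rewrite ?ba//.
by move=> u /mapP[i]; rewrite mem_iota => /andP[i6 _] ->; rewrite b0 ba// ltnW.
Qed.

End SignedSequences.

(** * From sign patterns to probabilities *)

Section Cylinders.
Variables (R : realType) (d : measure_display) (T : measurableType d).
Variables (P : probability T R) (n : nat) (eps : 'I_n -> {RV P >-> R}).

Definition signr (s : bool) : R := if s then 1 else -1.

Lemma signr_neq : signr true <> signr false.
Proof. by rewrite /signr; lra. Qed.

(** Written as an intersection over a finite index set, the form in which independence is stated. *)
Definition cylinder (k : nat) (s : nat -> bool) : set T :=
  \bigcap_(i in [set` [set i : 'I_n | (i < k)%N]%SET]) (eps i @^-1` [set signr (s i)]).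

Lemma cylinderP k s w :
  cylinder k s w <-> forall i : 'I_n, (i < k)%N -> eps i w = signr (s i).
Proof.
split=> [h i ik|h i /=]; first by apply: h; rewrite /= inE.
by rewrite inE; exact: h.
Qed.

Lemma measurable_cylinder k s : measurable (cylinder k s).
Proof.
apply: fin_bigcap_measurable; first exact: finite_finset.
by move=> i _; apply: measurable_funPTI; exact: measurable_set1.
Qed.

Lemma probability_cylinder s : rademacher_sequence eps ->
  P (cylinder n s) = (2^-1 ^+ n)%:E.
Proof.
move=> [ind sgn]; rewrite /cylinder ind; last by move=> i; exact: measurable_set1.
have e i : P (eps i @^-1` [set signr (s i)]) = (2^-1)%:E.
  by have [h1 h2] := sgn i; rewrite /signr; case: (s i).
under eq_bigr do rewrite e.
rewrite (eq_bigl xpredT) => [|i]; last by rewrite inE ltn_ord.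
by rewrite prodEFin prodr_const card_ord.
Qed.

(** The cylinders form a binary tree with masses [2^-1 ^+ k], and [savg] follows the same recursion.
    An inequality suffices, so the null set where some variable is not a sign needs no treatment. *)
Lemma savg_le_probability (b : nat -> R) (E : set T) : rademacher_sequence eps ->
  measurable E ->
  (forall s w, cylinder n s w -> 1 <= `|\sum_(i < n) signr (s i) * b i| -> E w) ->
  ((savg (mkseq b n) (outside 1) 0)%:E <= P E)%E.
Proof.
move=> heps mE hE.
(* Induction on the number [m] of undecided signs, for the walk restarted from the position fixed by
   the first [k] signs. *)
suff main m k (s : nat -> bool) : (k + m = n)%N ->
    ((2^-1 ^+ k * savg (map b (iota k m)) (outside 1) (\sum_(i < k) signr (s i) * b i))%:E
     <= P (E `&` cylinder k s))%E.
  have := main n 0%N xpredT erefl; rewrite expr0 mul1r big_ord0 => /le_trans; apply.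
  by apply: le_measure; rewrite ?inE//; apply: measurableI => //; exact: measurable_cylinder.
elim: m k s => [|m IH] k s.
  rewrite addn0 => kn; rewrite /= /outside kn.
  case: (leP 1 `|\sum_(i < n) signr (s i) * b i|) => h; last by rewrite mulr0.
  rewrite mulr1 -(probability_cylinder s heps).
  apply: le_measure; rewrite ?inE; [exact: measurable_cylinder| |].
    by apply: measurableI => //; exact: measurable_cylinder.
  by move=> w cw; split => //; exact: hE cw h.
move=> kmn; have kn : (k < n)%N by rewrite -kmn addnS ltnS leq_addr.
pose up c i := if i == k then c else s i.
have upk c : up c k = c by rewrite /up eqxx.
have sum_up c : \sum_(i < k.+1) signr (up c i) * b i =
    \sum_(i < k) signr (s i) * b i + signr c * b k.
  rewrite big_ord_recr /= upk; congr (_ + _); apply: eq_bigr => i _.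
  by rewrite /up ltn_eqF.
have cyl_up c : cylinder k.+1 (up c) `<=` cylinder k s.
  move=> w /cylinderP h; apply/cylinderP => i ik.
  by rewrite h ?(leq_trans ik)// /up ltn_eqF.
have mEC k' s' : measurable (E `&` cylinder k' s').
  by apply: measurableI => //; exact: measurable_cylinder.
have kmn' : (k.+1 + m = n)%N by rewrite addSnnS.
have h1 := IH _ (up true) kmn'; have h2 := IH _ (up false) kmn'.
apply: (@le_trans _ _ (P ((E `&` cylinder k.+1 (up true)) `|`
                          (E `&` cylinder k.+1 (up false))))); last first.
  apply: le_measure; rewrite ?inE//; first exact: measurableU.
  by move=> w [] [Ew cw]; split => //; exact: cyl_up cw.
rewrite measureU//; last first.
  rewrite -subset0 => w [[_ /cylinderP c1] [_ /cylinderP c2]].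
  have := c1 (Ordinal kn) (ltnSn k); rewrite (c2 (Ordinal kn) (ltnSn k)) /= !upk.
  by move/esym/signr_neq.
apply: le_trans (leeD h1 h2).
rewrite -EFinD lee_fin !sum_up /signr mul1r mulN1r /= /hold exprS.
by rewrite le_eqVlt; apply/orP; left; apply/eqP; field.
Qed.

End Cylinders.

Section Rescaling.
Variables (R : realType) (n : nat) (a : 'I_n -> R).

(* Scaling by [sqrt 3] moves the threshold to 1; the weights are continued by zeros. *)
Definition scaled_weight (i : nat) : R := oapp (fun j => Num.sqrt 3 * a j) 0 (insub i).

Lemma scaled_weight_ord (i : 'I_n) : scaled_weight i = Num.sqrt 3 * a i.
Proof. by rewrite /scaled_weight valK. Qed.

Lemma scaled_weight_ge i : (n <= i)%N -> scaled_weight i = 0.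
Proof. by move=> ni; rewrite /scaled_weight insubF// ltnNge ni. Qed.

Lemma mkseq_scaled_weight k :
  mkseq scaled_weight (n + k) = mkseq scaled_weight n ++ nseq k 0.
Proof.
rewrite /mkseq iotaD map_cat; congr (_ ++ _).
rewrite -[k in RHS](size_iota (0 + n) k) -(size_map scaled_weight).
apply/all_pred1P/allP => _ /mapP[i + ->].
by rewrite mem_iota add0n => /andP[/scaled_weight_ge-> _]; exact: eqxx.
Qed.

Hypothesis ha : unit_weights a.

Lemma scaled_weight_ge0 i : 0 <= scaled_weight i.
Proof.
have [_ a0 _] := ha; rewrite /scaled_weight; case: insubP => //= j _ _.
by rewrite mulr_ge0 ?sqrtr_ge0// ltW.
Qed.

Lemma scaled_weight_antitone i j : (i <= j)%N -> scaled_weight j <= scaled_weight i.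
Proof.
have [mono a0 _] := ha => ij.
have [jn|nj] := ltnP j n; last by rewrite (scaled_weight_ge nj) scaled_weight_ge0.
have i_n := leq_ltn_trans ij jn.
rewrite (scaled_weight_ord (Ordinal jn)) (scaled_weight_ord (Ordinal i_n)).
by rewrite ler_wpM2l ?sqrtr_ge0//; exact: mono.
Qed.

Lemma sumsq_scaled_weight k : sumsq (mkseq scaled_weight (n + k)) = 3.
Proof.
rewrite mkseq_scaled_weight /sumsq big_cat /=.
rewrite [X in _ + X]big1_seq ?addr0; last first.
  by move=> x /andP[_ /nseqP[-> _]]; rewrite expr0n.
rewrite big_map (_ : iota 0 n = index_iota 0 n) ?big_mkord; last by rewrite /index_iota subn0.
under eq_bigr do rewrite scaled_weight_ord exprMn sqr_sqrtr//.
by have [_ _ a1] := ha; rewrite -mulr_sumr a1 mulr1.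
Qed.

End Rescaling.

Theorem theorem5p3 (R : realType) (d : measure_display)
    (T : measurableType d) (P : probability T R) (n : nat)
    (a : 'I_n -> R) (eps : 'I_n -> {RV P >-> R})
    (ha : unit_weights a) (heps : rademacher_sequence eps) :
  ((3 / 8)%:E <=
    P [set w | (1 / Num.sqrt 3 <= `|rademacher_sum a eps w|)%R])%E.
Proof.
have s3 : 0 < Num.sqrt 3 :> R by rewrite sqrtr_gt0.
set E := [set w | _].
have mE : measurable E.
  have mf : measurable_fun [set: T] (fun w => `|rademacher_sum a eps w|).
    apply: measurableT_comp => //; apply: measurable_sum => i.
    by apply: measurable_realfun.measurable_funM => //; exact: measurable_cst.
  rewrite (_ : E = [set: T] `&` (fun w => `|rademacher_sum a eps w|) @^-1`
      [set` `[1 / Num.sqrt 3, +oo[]).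
    by apply: mf => //; exact: measurable_itv.
  rewrite setTI; apply/seteqP; split=> w; rewrite /E /= in_itv /= andbT; exact.
apply: le_trans (savg_le_probability (b := scaled_weight a) heps mE _).
  (* Six zero weights are appended, so that the case analysis on six leading weights applies for
     every [n]. *)
  rewrite lee_fin -(savg_nseq0 _ _ 6) -mkseq_scaled_weight addnC.
  apply: savg_antitone => [i j|i|].
  - exact: scaled_weight_antitone.
  - exact: scaled_weight_ge0.
  - by rewrite addnC; exact: sumsq_scaled_weight.
move=> s w /cylinderP cw; rewrite /E /= ler_pdivrMr// mulrC.
rewrite -[Num.sqrt 3 in X in _ -> X](gtr0_norm s3) -normrM.
rewrite /rademacher_sum mulr_sumr.
suff -> : \sum_(i < n) signr R (s i) * scaled_weight a i =
    \sum_(i < n) Num.sqrt 3 * (a i * eps i w) by [].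
by apply: eq_bigr => i _; rewrite scaled_weight_ord (cw i (ltn_ord i)); ring.
Qed.
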